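(* Let $X$ be a real random variable with a density $p$ and characteristic function $f(t)=\mathbb{E}\,e^{itX}$, $t\in\mathbb{R}$. Let $p_n$ denote the density of $Z_n=\frac{1}{\sqrt n}(X+X_1+\dots+X_n)$, where $(X_n)_{n\ge1}$ are independent Bernoulli random variables taking the values $\pm1$ with probability $1/2$ each, independent of $X$. (i) If $\|p_n-\varphi\|_2\to0$ as $n\to\infty$, then $f(\pi k)=0$ for all $k\in\mathbb{Z}$, $k\ne0$. (ii) Conversely, if $\mathbb{E}|X|<\infty$, $f'$ is square integrable on $\mathbb{R}$, and $f(\pi k)=0$ for all $k\in\mathbb{Z}$, $k\neq0$, then $\|p_n-\varphi\|_2\to0$ as $n\to\infty$.
   Context: $\varphi(x)=\frac{1}{\sqrt{2\pi}}e^{-x^2/2}$ is the standard normal density on $\mathbb{R}$, and $\|u\|_2=\big(\int_{-\infty}^\infty|u(x)|^2\,dx\big)^{1/2}$ (possibly $+\infty$). *)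

(* Defs.v *)
From HB Require Import structures.
From mathcomp Require Import all_boot all_order all_algebra.
From mathcomp Require Import finmap complex.
From mathcomp Require Import all_classical all_reals all_analysis.

Set Implicit Arguments.
Unset Strict Implicit.
Unset Printing Implicit Defensive.
Import Order.TTheory GRing.Theory Num.Theory.
Import numFieldNormedType.Exports.
Local Open Scope classical_set_scope.
Local Open Scope ring_scope.

Section random_variables.
Context d (T : measurableType d) (R : realType) (P : probability T R).

Definition has_density (X : T -> R) (p : R -> R) : Prop :=
  [/\ measurable_fun setT p,
      forall x, 0 <= p x
    & forall A, measurable A ->
        P (X @^-1` A) = (\int[lebesgue_measure]_(x in A) (p x)%:E)%E].

Definition mutually_independent (I : choiceType) (X : I -> T -> R) : Prop :=
  forall (J : {fset I}) (B : I -> set R),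
    (forall i, i \in J -> measurable (B i)) ->
    P (\bigcap_(i in [set` J]) (X i @^-1` B i)) =
    (\prod_(i <- J) P (X i @^-1` B i))%E.

Definition symmetric_bernoulli (Y : T -> R) : Prop :=
  P (Y @^-1` [set 1]) = (2^-1)%:E /\ P (Y @^-1` [set -1]) = (2^-1)%:E.

Definition expi (x : R) : R[i] := (cos x +i* sin x)%C.

(* Expectation and derivative of complex-valued functions are taken
   componentwise; `fine` and `derive1` return junk values when the expectation
   is infinite or the derivative does not exist. *)
Definition Cexpectation (Z : T -> R[i]) : R[i] :=
  (fine ('E_P[fun w => complex.Re (Z w)])%E +i*
   fine ('E_P[fun w => complex.Im (Z w)])%E)%C.

Definition char_fun (X : T -> R) (t : R) : R[i] :=
  Cexpectation (fun w => expi (t * X w)).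

(* X is not counted in the normalization, and the sum starts at Xs 1. *)
Definition norm_sum (X : T -> R) (Xs : nat -> T -> R) (n : nat) (w : T) : R :=
  (X w + \sum_(1 <= i < n.+1) Xs i w) / Num.sqrt n%:R.

End random_variables.

Section real_line.
Context (R : realType).

Definition Cderive1 (f : R -> R[i]) (t : R) : R[i] :=
  (derive1 (fun s => complex.Re (f s)) t +i*
   derive1 (fun s => complex.Im (f s)) t)%C.

Definition L2norm (u : R -> R) : \bar R :=
  'N[@lebesgue_measure R]_2%:E[EFin \o u]%E.

End real_line.

(* Main.v *)
Require Import Defs.
From HB Require Import structures.
From mathcomp Require Import all_boot all_order all_algebra.
From mathcomp Require Import finmap complex.
From mathcomp Require Import all_classical all_reals all_analysis.
From mathcomp Require Import measurable_realfun.
From mathcomp Require Import ring lra zify.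

Set Implicit Arguments.
Unset Strict Implicit.
Unset Printing Implicit Defensive.
Import Order.TTheory GRing.Theory Num.Theory.
Import numFieldNormedType.Exports.
Local Open Scope classical_set_scope.
Local Open Scope ring_scope.

(** Let W g x = (g (x + 1) + g (x - 1)) / 2 be one step of the simple random
    walk, acting on functions.  Then Z_n has density
    q_n x = sqrt n * (W^n p) (sqrt n * x), and W is self-adjoint on L2.

    Everything is done in real space, without Plancherel.  If f vanishes at the
    nonzero multiples of pi, testing p against the Fejer-like kernels
    cos^(2N) (pi (x - y) / 2) shows that the partial sums of
    sum_m p (x + 2m) are at most 1/2 almost everywhere.  Expanding W^(2n) with
    binomial coefficients, all at most 'C(2n, n) / 4^n <= 1 / sqrt (pi n), gives
      int q_n^2 = sqrt n * int p W^(2n) p <= 1 / (2 sqrt pi) = int phi^2,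
    while int q_n phi = int p Phi_n with Phi_n = W^n (phi (. / sqrt n)), and the
    heat semigroup shows Phi_n(0) >= int phi^2 - O(1/n).  Hence
    int (q_n - phi)^2 -> 0.

    Conversely, for c = cos (pi k .) or sin (pi k .) one has c (x + 1) = s * c x
    with s = +-1, so W^n (c g) = s^n c W^n g.  Testing q_n against
    c (sqrt n x) phi(x) therefore yields s^n (Phi_n(0) int p c + o(1)).
    Comparing with the uniform density on [-1, 1], for which the L2 convergence
    is already known and int p c = 0, forces int p c = 0. *)

(** * Elementary inequalities *)

Section calculus.
Context {R : realType}.
Implicit Types (f df : R -> R) (a b x y z : R).

Lemma is_derive_continuous f df :
  (forall x, is_derive x (1 : R) f (df x)) -> continuous f.
Proof.
by move=> fd x; apply/differentiable_continuous/derivable1_diffP; case: (fd x).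
Qed.

Lemma is_derive_MVT f df : (forall x, is_derive x (1 : R) f (df x)) ->
  forall a b, a <= b -> exists2 c, a <= c <= b & f b - f a = df c * (b - a).
Proof.
move=> fd a b ab; have fc := is_derive_continuous fd.
have [c] := @MVT_segment R f df a b ab (fun x _ => fd x) (continuous_subspaceT fc).
by rewrite in_itv /=; exists c.
Qed.

Lemma is_derive_ge0_homo f df a b : (forall x, is_derive x (1 : R) f (df x)) ->
  (forall x, a <= x <= b -> 0 <= df x) -> a <= b -> f a <= f b.
Proof.
move=> fd df0 ab; have [c acb fE] := is_derive_MVT fd ab.
by rewrite -subr_ge0 fE mulr_ge0 ?df0// subr_ge0.
Qed.

Lemma sin_ge_xcos x : 0 <= x <= pi / 2 -> x * cos x <= sin x.
Proof.
move=> /andP[x0 xpi]; rewrite -subr_ge0.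
have d y : is_derive y (1 : R) (fun y => sin y - y * cos y) (y * sin y).
  by apply: is_derive_eq; rewrite /GRing.scale /=; ring.
have := is_derive_ge0_homo d _ x0; rewrite sin0 mul0r subrr; apply => y /andP[y0 yx].
rewrite mulr_ge0// sin_ge0_pi// y0 (le_trans yx)// (le_trans xpi)//.
by have := @pi_gt0 R; lra.
Qed.

(** On [0, pi/2] the product cos y * exp (y^2 / 2) decreases, since its derivative has the sign of y
    cos y - sin y; evenness covers the other half. It lets powers of the cosine be compared with
    Gaussians. *)
Lemma cos_le_gauss x : `|x| <= pi / 2 -> cos x <= expR (- (x ^+ 2 / 2)).
Proof.
wlog x0 : x / 0 <= x.
  move=> h; have [/h//|x0] := leP 0 x; rewrite -(cosN x) -(sqrrN x) -(normrN x).
  by apply: h; lra.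
rewrite ger0_norm// => xpi; rewrite expRN -[leRHS]div1r ler_pdivlMr// ?expR_gt0//.
have d y : is_derive y (1 : R) (fun y => - (cos y * expR (y ^+ 2 / 2)))
    ((sin y - y * cos y) * expR (y ^+ 2 / 2)).
  by apply: is_derive_eq; rewrite /GRing.scale /=; field.
have := is_derive_ge0_homo d _ x0.
rewrite cos0 expr0n mul0r expR0 mulr1 lerN2; apply => y /andP[y0 yx].
by rewrite mulr_ge0 ?expR_ge0// subr_ge0 sin_ge_xcos// y0 (le_trans yx).
Qed.

Lemma cosh_ge1 z : 2 <= expR z + expR (- z).
Proof.
rewrite expRN; have := expR_gt0 z; set e := expR z => e0.
by rewrite -subr_ge0 (_ : _ - _ = (e - 1) ^+ 2 / e) ?divr_ge0 ?sqr_ge0 1?ltW//;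
  field; rewrite gt_eqF.
Qed.

(** By evenness take z >= 0. The difference of the two sides vanishes to first order at 0, and its
    second derivative is nonnegative by [cosh_ge1]. *)
Lemma cosh_ge_quadratic z : 2 + z ^+ 2 <= expR z + expR (- z).
Proof.
wlog z0 : z / 0 <= z.
  move=> h; have [/h//|z0] := leP 0 z.
  by have := h (- z); rewrite sqrrN opprK (addrC (expR (- z))); apply; lra.
have d1 y : is_derive y (1 : R) (fun y => expR y - expR (- y) - 2 * y)
    (expR y + expR (- y) - 2).
  by apply: is_derive_eq; rewrite /GRing.scale /=; ring.
have d2 y : is_derive y (1 : R) (fun y => expR y + expR (- y) - y ^+ 2)
    (expR y - expR (- y) - 2 * y).
  by apply: is_derive_eq; rewrite /GRing.scale /=; ring.
have := is_derive_ge0_homo d2 _ z0; rewrite expr0n oppr0 expR0 addr0 => h.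
rewrite -lerBrDr; apply: le_trans (h _); first by lra.
move=> y /andP[y0 _]; have := is_derive_ge0_homo d1 _ y0.
rewrite mulr0 oppr0 expR0 subrr addr0; apply => w _.
by rewrite subr_ge0 cosh_ge1.
Qed.

End calculus.
(** * The walk operator *)

Lemma leq_bin_incr m j : (j.*2 < m)%N -> ('C(m, j) <= 'C(m, j.+1))%N.
Proof.
move=> jm; have jm' : (j.+1 <= m - j)%N by rewrite leq_subRL; lia.
rewrite -(leq_pmul2l (ltn0Sn j)) mul_bin_left leq_mul2r.
by rewrite jm' orbT.
Qed.

Lemma leq_bin_central n j : ('C(n.*2, j) <= 'C(n.*2, n))%N.
Proof.
(* Left half: the coefficients decrease when moving away from the centre. The right half follows by
   symmetry. *)
have low i : (i <= n)%N -> ('C(n.*2, n - i) <= 'C(n.*2, n))%N.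
  elim: i => [|i IH] lein; first by rewrite subn0.
  apply: leq_trans (IH (ltnW lein)).
  rewrite -[X in (_ <= 'C(_, X))%N](@subnSK i n)//; apply: leq_bin_incr; lia.
have [jn|nj] := leqP j n; first by rewrite -(subKn jn); apply/low/leq_subr.
have [j2n|nj2] := leqP j n.*2; last by rewrite bin_small.
by rewrite -bin_sub// (_ : n.*2 - j = n - (j - n))%N; [apply: low|]; lia.
Qed.

Section walk.
Context {R : realType}.
Implicit Types (f g c : R -> R) (x : R).

Definition walk g x := (g (x + 1) + g (x - 1)) / 2.

Lemma iter_walkE n g x : iter n walk g x =
  \sum_(j < n.+1) 'C(n, j)%:R / 2 ^+ n * g (x + (n%:R - 2 * j%:R)).
Proof.
elim: n x => [|n IH] x.
  by rewrite big_ord_recl big_ord0 /= bin0 expr0 divr1 mul1r mulr0 subrr !addr0.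
rewrite iterS /walk !IH.
pose a j := g (x + (n.+1%:R - 2 * j%:R)).
(* With [j] counting the steps -1, an extra step +1 keeps [j] and an extra step -1 raises it;
   Pascal's rule merges the two sums. *)
have e1 : \sum_(j < n.+1) 'C(n, j)%:R / 2 ^+ n * g (x + 1 + (n%:R - 2 * j%:R)) =
    (a 0%N + \sum_(j < n.+1) 'C(n, j.+1)%:R * a j.+1) / 2 ^+ n.
  transitivity ((\sum_(j < n.+2) 'C(n, j)%:R * a j) / 2 ^+ n).
    rewrite [in RHS]big_ord_recr /= bin_small// mul0r addr0 big_distrl /=.
    apply: eq_bigr => j _; rewrite mulrAC /a; congr (_ * g _ / _).
    by rewrite -natr1; ring.
  by rewrite big_ord_recl bin0 mul1r.
have e2 : \sum_(j < n.+1) 'C(n, j)%:R / 2 ^+ n * g (x - 1 + (n%:R - 2 * j%:R)) =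
    (\sum_(j < n.+1) 'C(n, j)%:R * a j.+1) / 2 ^+ n.
  rewrite big_distrl /=; apply: eq_bigr => j _.
  by rewrite mulrAC /a; congr (_ * g _ / _); rewrite -!natr1; ring.
rewrite e1 e2 [in RHS]big_ord_recl bin0 /= -[g _]/(a 0%N).
rewrite [X in _ = _ + X](eq_bigr (fun j : 'I_n.+1 =>
   ('C(n, j.+1)%:R * a j.+1 + 'C(n, j)%:R * a j.+1) / 2 ^+ n.+1)).
  by rewrite -big_distrl big_split /= exprS; field; rewrite expf_neq0 ?pnatr_eq0.
by move=> j _; rewrite /bump /= add1n binS natrD mulrAC mulrDl.
Qed.

Lemma eq_walk f g : f =1 g -> walk f =1 walk g.
Proof. by move=> fg x; rewrite /walk !fg. Qed.

Lemma iter_walkM n c g s : (forall x, c (x + 1) = s * c x) ->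
  (forall x, c (x - 1) = s * c x) ->
  iter n walk (fun x => c x * g x) =1 (fun x => s ^+ n * (c x * iter n walk g x)).
Proof.
move=> cD cB; elim: n => [|n IH] x; first by rewrite expr0 mul1r.
by rewrite !iterS (eq_walk IH) /walk cD cB exprS; field.
Qed.

(** Cosines are eigenfunctions of [walk], with eigenvalue cos t. Evaluating at 0 and comparing with
    [iter_walkE] yields the Fourier expansion of a power of the cosine. *)
Lemma iter_walk_cos n (t x : R) :
  iter n walk (fun x => cos (t * x)) x = cos t ^+ n * cos (t * x).
Proof.
elim: n x => [|n IH] x; first by rewrite expr0 mul1r.
rewrite iterS (eq_walk IH) /walk mulrDr mulrBr mulr1 cosD cosB exprS.
by field.
Qed.

Lemma le_iter_walk n f g :
  (forall x, f x <= g x) -> forall x, iter n walk f x <= iter n walk g x.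
Proof.
move=> fg; elim: n => [//|n IH] x; rewrite !iterS /walk.
by rewrite ler_pM2r ?invr_gt0// lerD.
Qed.

Lemma iter_walk_cst n k x : iter n walk (cst k) x = k.
Proof.
elim: n x => [//|n IH] x; rewrite iterS /walk !IH; by field.
Qed.

Lemma iter_walk_ge0 n g : (forall x, 0 <= g x) -> forall x, 0 <= iter n walk g x.
Proof.
by move=> g0 x; rewrite -(iter_walk_cst n 0 x); exact: le_iter_walk.
Qed.

Lemma iter_walk_le n g k :
  (forall x, g x <= k) -> forall x, iter n walk g x <= k.
Proof.
by move=> gk x; rewrite -[leRHS](iter_walk_cst n k x); exact: le_iter_walk.
Qed.

Lemma iter_walk_norm_le n g k :
  (forall x, `|g x| <= k) -> forall x, `|iter n walk g x| <= k.
Proof.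
move=> gk x; rewrite ler_norml -{1}(iter_walk_cst n (- k) x).
rewrite le_iter_walk ?iter_walk_le// => y; by have := gk y; rewrite ler_norml => /andP[].
Qed.

Lemma iter_walk_lipschitz n g k : (forall x y, `|g x - g y| <= k * `|x - y|) ->
  forall x y, `|iter n walk g x - iter n walk g y| <= k * `|x - y|.
Proof.
move=> gk; elim: n => [//|n IH] x y; rewrite !iterS /walk.
set h := iter n walk g in IH *.
rewrite (_ : _ - _ = ((h (x + 1) - h (y + 1)) + (h (x - 1) - h (y - 1))) / 2);
  last by ring.
rewrite normrM (ger0_norm (_ : 0 <= 2^-1)) ?invr_ge0// ler_pdivrMr//.
apply: (le_trans (ler_normD _ _)); rewrite mulr2n mulrDr mulr1 lerD//.
  by apply: le_trans (IH _ _) _; rewrite (_ : _ - _ = x - y)//; ring.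
by apply: le_trans (IH _ _) _; rewrite (_ : _ - _ = x - y)//; ring.
Qed.

Lemma measurable_walk g : measurable_fun setT g -> measurable_fun setT (walk g).
Proof.
move=> mg; apply: measurable_funM => //; apply: measurable_funD.
  by apply: (measurableT_comp mg); exact: measurable_funD.
by apply: (measurableT_comp mg); exact: measurable_funD.
Qed.

Lemma measurable_iter_walk n g :
  measurable_fun setT g -> measurable_fun setT (iter n walk g).
Proof. by move=> mg; elim: n => [//|n IH]; exact: measurable_walk. Qed.

End walk.
(** * The heat kernel along the walk *)

Section heat_kernel.
Context {R : realType}.
Implicit Types (s h x t u : R).

(** The parameter [s] is the variance, whereas [normal_pdf] takes a standard deviation: variances
    add along the heat semigroup. *)
Definition gauss_density s x := (Num.sqrt (2 * pi * s))^-1 * expR (- (x ^+ 2 / (2 * s))).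

Lemma normal_pdf01E : normal_pdf 0 1 = gauss_density 1.
Proof.
apply/funext => x; rewrite normal_pdfE// /normal_peak /normal_fun /gauss_density.
rewrite subr0 expr1n mul1r !mulr1 mulNr; congr (((Num.sqrt _)^-1) * expR (- (_ / _))).
by rewrite mulr_natl.
Qed.

Lemma gauss_density_cst_le1 s : 1 <= s -> (Num.sqrt (2 * pi * s))^-1 <= 1.
Proof.
move=> s1; rewrite invf_le1 ?sqrtr_gt0; last by rewrite !mulr_gt0 ?pi_gt0//; lra.
rewrite -[leLHS]sqrtr1 ler_sqrt; last by rewrite !mulr_ge0 ?pi_ge0//; lra.
have p2 := @pi_ge2 R; have : 0 <= (pi - 2) * (s - 1) by rewrite mulr_ge0 ?subr_ge0.
by nra.
Qed.

Lemma gauss_density_ge0 s x : 0 <= gauss_density s x.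
Proof. by rewrite mulr_ge0 ?expR_ge0// invr_ge0 sqrtr_ge0. Qed.

Lemma gauss_density_le1 s x : 1 <= s -> gauss_density s x <= 1.
Proof.
move=> s1; rewrite mulr_ile1 ?expR_ge0 ?invr_ge0 ?sqrtr_ge0 ?gauss_density_cst_le1//.
by rewrite expR_le1 oppr_le0 divr_ge0 ?sqr_ge0//; lra.
Qed.

(** Here exp t = exp (t/2)^2 >= (1 + t/2)^2 >= t^2 / 4. *)
Lemma expRN_sqr_le t : 0 <= t -> expR (- t) * t ^+ 2 <= 4.
Proof.
move=> t0; rewrite expRN mulrC ler_pdivrMr ?expR_gt0//.
rewrite (_ : t = t / 2 + t / 2); last by field.
rewrite expRD; have := expR_ge1Dx (t / 2); set e := expR _ => e1.
have : 0 <= t / 2 by lra.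
nra.
Qed.

(** After squaring, the gap (1 + h) * rhs^2 - 1 is displayed as a sum of terms that are nonnegative
    on [0, 1]. *)
Lemma invsqrt_le h : 0 <= h <= 1 -> (Num.sqrt (1 + h))^-1 <= 1 - h / 2 + h ^+ 2 / 2.
Proof.
move=> /andP[h0 h1]; have s0 : 0 < Num.sqrt (1 + h) by rewrite sqrtr_gt0; lra.
rewrite -[leLHS]mul1r ler_pdivrMr//.
have t0 : 0 <= 1 - h / 2 + h ^+ 2 / 2 by nra.
rewrite -(@ler_pXn2r _ 2)// ?nnegrE ?mulr_ge0 ?(ltW s0)//.
rewrite exprMn sqr_sqrtr ?expr1n; last by lra.
rewrite -subr_ge0 (_ : _ - 1 =
  h ^+ 2 / 4 + h ^+ 3 / 2 + h ^+ 3 * (1 - h) / 4 + h ^+ 5 / 4).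
  by rewrite !addr_ge0// divr_ge0// ?mulr_ge0 ?exprn_ge0 ?subr_ge0.
by field.
Qed.

(** Scalar core of [heat_step], with u = x^2 / (s + h) and [h] standing for h / s. Both sides agree
    to first order in h. Bounding the last factor below by 1 - z^2 costs 4 h^2, and comparing 1 /
    sqrt (1 + h) with exp (- h / 2) costs h^2, hence the constant 5. *)
Lemma heat_factor_ge u h : 0 <= u -> 0 <= h <= 1 ->
  (Num.sqrt (1 + h))^-1 * expR (- (u / 2)) - 5 * h ^+ 2 <=
  expR (- (u / 2)) * expR (- (h / 2)) * (expR (- (u * h / 2)) * (1 + u * h / 2)).
Proof.
move=> u0 /andP[h0 h1]; set z := u * h / 2.
have z0 : 0 <= z by rewrite divr_ge0// mulr_ge0.
have [A0 A1] : 0 < expR (- (u / 2)) /\ expR (- (u / 2)) <= 1.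
  by rewrite expR_gt0 expR_le1 oppr_le0 divr_ge0.
have [E0 E1] : 1 - h / 2 <= expR (- (h / 2)) /\ expR (- (h / 2)) <= 1.
  by rewrite expR_ge1Dx expR_le1 oppr_le0 divr_ge0.
have Az : expR (- (u / 2)) * z ^+ 2 <= 4 * h ^+ 2.
  rewrite (_ : z ^+ 2 = (u / 2) ^+ 2 * h ^+ 2); last by rewrite /z; field.
  by rewrite mulrA ler_wpM2r ?sqr_ge0// expRN_sqr_le// divr_ge0.
have a1 := invsqrt_le (introT andP (conj h0 h1)).
have ez : 1 - z ^+ 2 <= expR (- z) * (1 + z).
  apply: (@le_trans _ _ ((1 - z) * (1 + z))); first by rewrite -subr_ge0; nra.
  by rewrite ler_wpM2r ?expR_ge1Dx//; lra.
set A := expR (- (u / 2)) in A0 A1 Az *.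
set E := expR (- (h / 2)) in E0 E1 *.
set a := (Num.sqrt (1 + h))^-1 in a1 *.
have E00 : 0 <= E by exact: expR_ge0.
apply: (@le_trans _ _ (A * E * (1 - z ^+ 2))); last first.
  by rewrite ler_wpM2l// mulr_ge0// ltW.
have AE : A * E * z ^+ 2 <= A * z ^+ 2.
  by rewrite ler_wpM2r ?sqr_ge0// ler_piMr// ltW.
have Aa : A * (a - E) <= h ^+ 2.
  apply: (@le_trans _ _ (A * (h ^+ 2 / 2))).
    by apply: ler_wpM2l; [exact: ltW|lra].
  have h2 := sqr_ge0 h; have : 0 <= (1 - A) * h ^+ 2 by rewrite mulr_ge0 ?subr_ge0.
  nra.
lra.
Qed.

(** A step of length sqrt h has variance h, so it matches the heat semigroup at time h up to O(h^2).
    Factoring out the Gaussian in x leaves cosh w with w = x sqrt h / s, and cosh w >= 1 + w^2 / 2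
    >= 1 + u e / 2 because w^2 = u e (1 + e). *)
Lemma heat_step s h x : 1 <= s -> 0 < h <= 1 ->
  gauss_density (s + h) x - 5 * h ^+ 2 <=
  (gauss_density s (x + Num.sqrt h) + gauss_density s (x - Num.sqrt h)) / 2.
Proof.
move=> s1 /andP[h0 h1]; have s0 : 0 < s by lra.
have sn0 : s != 0 by rewrite gt_eqF.
have shn0 : s + h != 0 by rewrite gt_eqF//; lra.
have r2 : Num.sqrt h ^+ 2 = h by rewrite sqr_sqrtr// ltW.
set r := Num.sqrt h in r2 *.
have [e0 e1] : 0 <= h / s /\ h / s <= h.
  by rewrite divr_ge0 ?(ltW h0) ?(ltW s0)// ler_pdivrMr// ler_peMr// ltW.
have u0 : 0 <= x ^+ 2 / (s + h) by rewrite divr_ge0 ?sqr_ge0//; lra.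
set e := h / s in e0 e1; set u := x ^+ 2 / (s + h) in u0.
have K1 := gauss_density_cst_le1 s1.
have K0 : 0 <= (Num.sqrt (2 * pi * s))^-1 by rewrite invr_ge0 sqrtr_ge0.
have H := heat_factor_ge u0 (introT andP (conj e0 (le_trans e1 h1))).
have -> : gauss_density (s + h) x =
    (Num.sqrt (2 * pi * s))^-1 * ((Num.sqrt (1 + e))^-1 * expR (- (u / 2))).
  rewrite /gauss_density mulrA -invfM -sqrtrM; last first.
    by rewrite !mulr_ge0 ?pi_ge0// ltW.
  congr ((Num.sqrt _)^-1 * expR (- _)); first by rewrite /e; field.
  by rewrite /u; field.
pose w := x * r / s.
have -> : (gauss_density s (x + r) + gauss_density s (x - r)) / 2 =
    (Num.sqrt (2 * pi * s))^-1 * (expR (- (u / 2)) * expR (- (e / 2)) *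
      (expR (- (u * e / 2)) * ((expR (- w) + expR w) / 2))).
  (* One identity serves both signs of the step: the last term vanishes at y = 1 and y = -1. *)
  have E (y : R) : - ((x + y * r) ^+ 2 / (2 * s)) =
      - (u / 2) + - (e / 2) + - (u * e / 2) - x * (y * r) / s -
      (y ^+ 2 - 1) * h / (2 * s).
    rewrite sqrrD exprMn r2 /u /e; field.
    by rewrite sn0.
  rewrite /gauss_density -mulrDr -mulrA; congr (_ * _).
  have := E 1; have := E (-1); rewrite !mul1r mulN1r => -> ->.
  rewrite expr1n sqrrN expr1n subrr !mul0r !subr0 mulrN mulNr opprK -/w !expRD.
  by rewrite -!mulrDr mulrA -!mulrA.
set K := (Num.sqrt (2 * pi * s))^-1 in K0 K1 *.
apply: (@le_trans _ _ (K * ((Num.sqrt (1 + e))^-1 * expR (- (u / 2)) - 5 * e ^+ 2))).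
  rewrite mulrBr lerB// -[leRHS]mul1r; apply: ler_pM => //.
    by rewrite mulr_ge0// sqr_ge0.
  by rewrite ler_wpM2l// ler_pXn2r// nnegrE ltW.
rewrite ler_wpM2l//; apply: (le_trans H).
rewrite ler_wpM2l ?mulr_ge0 ?expR_ge0// ler_wpM2l ?expR_ge0//.
rewrite ler_pdivlMr// addrC (addrC (expR (- w))); apply: le_trans (cosh_ge_quadratic w).
rewrite mulrDl addrC mul1r lerD2l divfK//.
rewrite (_ : w ^+ 2 = u * e * (1 + e)).
  by apply: ler_peMr; [exact: mulr_ge0|rewrite lerDl].
rewrite /w /u /e exprMn exprMn r2; field.
by rewrite sn0.
Qed.

End heat_kernel.

(** * The standard normal density at the scale of the walk *)

Section rescaled_gauss.
Context {R : realType}.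
Implicit Types (n : nat) (x y : R).

Lemma gauss_density20 : gauss_density 2 0 = (2 * Num.sqrt pi)^-1 :> R.
Proof.
rewrite /gauss_density expr0n mul0r oppr0 expR0 mulr1; congr (_^-1).
rewrite mulrAC sqrtrM ?mulr_ge0// (_ : 2 * 2 = 2 ^+ 2 :> R) ?expr2//.
by rewrite sqrtr_sqr ger0_norm.
Qed.

Lemma normal_pdf_lipschitz x y : `|normal_pdf 0 1 x - normal_pdf 0 1 y| <= `|x - y|.
Proof.
wlog xy : x y / y <= x.
  move=> h; have [/h//|/ltW/h] := leP y x.
  by rewrite distrC (distrC y).
rewrite normal_pdf01E.
have d z : is_derive z (1 : R) (gauss_density 1) (- z * gauss_density 1 z).
  rewrite /gauss_density; move: (Num.sqrt _)^-1 => K.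
  by apply: is_derive_eq; rewrite /GRing.scale /=; field.
have [c _ ->] := is_derive_MVT d xy.
rewrite normrM ler_piMl// normrM normrN (ger0_norm (gauss_density_ge0 _ _)).
rewrite /gauss_density mulrCA mulr_ile1 ?invr_ge0 ?sqrtr_ge0 ?mulr_ge0 ?expR_ge0//.
  exact: gauss_density_cst_le1.
rewrite mulr1 expRN ler_pdivrMr ?expR_gt0// mul1r.
apply: le_trans (expR_ge1Dx _); rewrite -(real_normK (num_real c)).
have := sqr_ge0 (`|c| - 1); nra.
Qed.

(** There is no factor 1 / sqrt n: this is a test function bounded by 1, not a density. *)
Definition scaled_pdf n x : R := normal_pdf 0 1 (x / Num.sqrt n%:R).

Lemma scaled_pdf_ge0 n x : 0 <= scaled_pdf n x.
Proof. exact: normal_pdf_ge0. Qed.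

Lemma scaled_pdf_le1 n x : scaled_pdf n x <= 1.
Proof. by rewrite /scaled_pdf normal_pdf01E gauss_density_le1. Qed.

Lemma measurable_scaled_pdf n : measurable_fun setT (scaled_pdf n).
Proof.
apply: measurableT_comp; first exact: measurable_normal_pdf.
exact: measurable_funM.
Qed.

Lemma iter_walk_scaled_pdf_lipschitz n x y :
  `|iter n walk (scaled_pdf n) x - iter n walk (scaled_pdf n) y| <=
  (Num.sqrt n%:R)^-1 * `|x - y|.
Proof.
apply: iter_walk_lipschitz => {}x {}y; apply: le_trans (normal_pdf_lipschitz _ _) _.
by rewrite -mulrBl normrM [X in _ * X]ger0_norm ?invr_ge0 ?sqrtr_ge0// mulrC.
Qed.

(* Each of the n steps adds 1/n to the variance of the Gaussian and costs at
   most 5 / n^2; after n steps the variance is 2. *)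
Lemma iter_walk_scaled_pdf_ge n : (0 < n)%N ->
  (2 * Num.sqrt pi)^-1 - 5 / n%:R <= iter n walk (scaled_pdf n) 0.
Proof.
move=> n0; have nR : 0 < n%:R :> R by rewrite ltr0n.
have n1 : 1 <= n%:R :> R by rewrite ler1n.
have main k x : (k <= n)%N ->
    gauss_density (1 + k%:R / n%:R) (x / Num.sqrt n%:R) - 5 * k%:R / n%:R ^+ 2 <=
    iter k walk (scaled_pdf n) x.
  elim: k x => [|k IH] x kn.
    by rewrite mul0r mulr0 mul0r addr0 subr0 /scaled_pdf normal_pdf01E.
  have s1 : 1 <= 1 + k%:R / n%:R :> R by rewrite lerDl divr_ge0.
  have h1 : 0 < (n%:R^-1 : R) <= 1 by rewrite invr_gt0 nR invf_le1.
  (* In the variable x / sqrt n a step of the walk has length sqrt (1/n), so h = 1/n. *)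
  have := @heat_step R _ _ (x / Num.sqrt n%:R) s1 h1.
  have := IH (x + 1) (ltnW kn); have := IH (x - 1) (ltnW kn).
  rewrite -addrA (mulrBl _ x) (mulrDl x 1) mul1r -sqrtrV; last exact: ltW.
  rewrite -[in X in _ -> _ -> _ -> X]natr1 (mulrDl k%:R) mul1r mulrDr -mulrA.
  rewrite (mulrDl _ _ (_ ^+ 2)^-1) iterS {3}/walk exprVn.
  move: (n%:R ^+ 2)^-1 => iv; lra.
rewrite -gauss_density20; have := main n 0 (leqnn n).
rewrite mul0r divff ?gt_eqF// => h; apply: le_trans h.
by rewrite (_ : 5 * _ / _ = 5 / n%:R)//; field; rewrite gt_eqF.
Qed.

End rescaled_gauss.
(** * Powers of the cosine *)

Section kernel.
Context {R : realType}.
Implicit Types (k m : int) (u x d e : R) (N : nat).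

Lemma sin_pi_int k : sin (pi * k%:~R) = 0 :> R.
Proof.
have nat_case n : sin (pi * n%:R) = 0 :> R.
  rewrite mulr_natr -[X in sin X]add0r (alternatingn (@sinDpi R)) sin0 mulr0//.
by case: k => n; rewrite ?NegzE ?mulrNz ?mulrN ?sinN -pmulrn nat_case ?oppr0.
Qed.

Lemma cos_add_int_period k x : cos (x + pi * 2 * k%:~R) = cos x :> R.
Proof.
have nat_case n y : cos (y + pi * 2 * n%:R) = cos y :> R.
  by rewrite mulr_natr mulr_natr (periodicn (@cosD2pi R)).
case: k => n; first exact: nat_case.
by rewrite NegzE mulrNz -pmulrn -(nat_case n.+1) mulrN subrK.
Qed.

Lemma sin_add_int_period k x : sin (x + pi * 2 * k%:~R) = sin x :> R.
Proof.
by rewrite -!cosBpihalf addrAC cos_add_int_period.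
Qed.

(** The antiderivative of cos (pi k u) that vanishes at 0. Only for k = 0 does it fail to have
    period 2. *)
Definition sin_primitive k u : R :=
  if k == 0 then u else sin (pi * k%:~R * u) / (pi * k%:~R).

Lemma is_derive_sin_primitive k u :
  is_derive u (1 : R) (sin_primitive k) (cos (pi * k%:~R * u)).
Proof.
rewrite /sin_primitive; have [->|k0] := eqVneq k 0.
  by rewrite mulr0z mulr0 mul0r cos0; exact: is_derive_id.
have c0 : pi * k%:~R != 0 :> R by rewrite mulf_neq0 ?intr_eq0// gt_eqF ?pi_gt0.
move: (pi * _) c0 => c c0.
by apply: is_derive_eq; rewrite /GRing.scale /=; field.
Qed.

Lemma sin_primitiveN k u : sin_primitive k (- u) = - sin_primitive k u.
Proof. by rewrite /sin_primitive; case: ifP => //; rewrite mulrN sinN mulNr. Qed.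

Lemma sin_primitive1 k : sin_primitive k 1 = (k == 0)%:R.
Proof.
by rewrite /sin_primitive; case: ifP => // _; rewrite mulr1 sin_pi_int mul0r.
Qed.

Lemma sin_primitive_period k m u :
  sin_primitive k (u + 2 * m%:~R) = sin_primitive k u + (k == 0)%:R * (2 * m%:~R).
Proof.
rewrite /sin_primitive; case: ifP => _; first by rewrite mul1r.
rewrite mul0r addr0; congr (_ / _).
rewrite -[RHS](sin_add_int_period (k * m)) intrM; congr (sin _); ring.
Qed.

(** The probability that the walk is back at 0 after 2N steps, and also the mean of cos^(2N) (pi u /
    2) over a period. *)
Definition central_bin N : R := 'C(N.*2, N)%:R / 2 ^+ N.*2.

Lemma central_bin_gt0 N : 0 < central_bin N.
Proof. by rewrite divr_gt0 ?exprn_gt0// ltr0n bin_gt0 -addnn leq_addr. Qed.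

(** The odd antiderivative of the kernel cos^(2N) (pi u / 2), taken term by term in its Fourier
    expansion; the frequencies are multiples of pi, where [f] is assumed to vanish. *)
Definition kernel_primitive N u : R :=
  \sum_(j < N.*2.+1) 'C(N.*2, j)%:R / 2 ^+ N.*2 *
    sin_primitive (N%:Z - j%:Z) u.

Lemma cos_exprE N u : cos (pi * u / 2) ^+ N.*2 =
  \sum_(j < N.*2.+1) 'C(N.*2, j)%:R / 2 ^+ N.*2 *
    cos (pi * (N%:Z - j%:Z)%:~R * u).
Proof.
have := iter_walk_cos N.*2 (pi * u / 2) 0; rewrite mulr0 cos0 mulr1 => <-.
rewrite iter_walkE; apply: eq_bigr => j _; congr (_ * cos _).
rewrite add0r (_ : N.*2%:R = N%:R * 2); last by rewrite -natrM muln2.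
by rewrite intrB -!pmulrn; field.
Qed.

Lemma is_derive_kernel_primitive N u :
  is_derive u (1 : R) (kernel_primitive N) (cos (pi * u / 2) ^+ N.*2).
Proof.
rewrite cos_exprE /kernel_primitive.
have d (j : 'I_N.*2.+1) : is_derive u (1 : R)
    (fun u => 'C(N.*2, j)%:R / 2 ^+ N.*2 * sin_primitive (N%:Z - j%:Z) u)
    ('C(N.*2, j)%:R / 2 ^+ N.*2 * cos (pi * (N%:Z - j%:Z)%:~R * u)).
  have := is_derive_sin_primitive (N%:Z - j%:Z) u.
  by move=> ?; exact: is_deriveZ.
have := is_derive_sum d; rewrite (_ : \sum_i _ = kernel_primitive N)//.
by apply/funext => v; rewrite /kernel_primitive fct_sumE.
Qed.

(** Only the zero frequency j = N survives. Every sum below in which the nonzero frequencies cancel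
    is evaluated this way. *)
Lemma central_coef_sum N (x : R) :
  \sum_(j < N.*2.+1) 'C(N.*2, j)%:R / 2 ^+ N.*2 *
    ((N%:Z - j%:Z == 0)%:R * x) = central_bin N * x.
Proof.
have NN : (N < N.*2.+1)%N by rewrite ltnS -addnn leq_addr.
rewrite (bigD1 (Ordinal NN))//= subrr eqxx mul1r big1 ?addr0// => j jN.
rewrite subr_eq0 eqz_nat (_ : (N == j) = false) ?mul0r ?mulr0//.
by apply/negbTE; apply: contra jN => /eqP jN; apply/eqP/val_inj.
Qed.

Lemma kernel_primitiveN N u : kernel_primitive N (- u) = - kernel_primitive N u.
Proof.
rewrite /kernel_primitive -sumrN; apply: eq_bigr => j _.
by rewrite sin_primitiveN mulrN.
Qed.

Lemma kernel_primitive0 N : kernel_primitive N 0 = 0.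
Proof.
have := kernel_primitiveN N 0; rewrite oppr0; lra.
Qed.

Lemma kernel_primitive1 N : kernel_primitive N 1 = central_bin N.
Proof.
rewrite -[RHS]mulr1 -central_coef_sum; apply: eq_bigr => j _.
by rewrite sin_primitive1 mulr1.
Qed.

Lemma kernel_primitive_period N m u :
  kernel_primitive N (u + 2 * m%:~R) = kernel_primitive N u + central_bin N * (2 * m%:~R).
Proof.
rewrite -central_coef_sum -big_split /=; apply: eq_bigr => j _.
by rewrite sin_primitive_period mulrDr.
Qed.

Lemma kernel_primitive_le N u x : u <= x -> kernel_primitive N u <= kernel_primitive N x.
Proof.
move=> ux; apply: (is_derive_ge0_homo (@is_derive_kernel_primitive N)) => // y _.
by rewrite -muln2 exprM sqr_ge0.
Qed.

(** The kernel concentrates at 0: the mass on [d, 1] is at most a^N, while [0, d/2] alone carries at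
    least (d/2) b^N with a < b. The mass on [0, 1] is [central_bin N]. *)
Lemma kernel_primitive_mass d e : 0 < d < 1 -> 0 < e ->
  exists N, (1 - e) * central_bin N <= kernel_primitive N d.
Proof.
move=> /andP[d0 d1] e0; pose a := cos (pi * d / 2) ^+ 2.
pose b := cos (pi * (d / 2) / 2) ^+ 2.
have p0 := @pi_gt0 R.
have cd x y : 0 <= x -> x < y -> y < 1 -> 0 < cos (pi * y / 2) < cos (pi * x / 2).
  move=> x0 xy y1; have px : 0 <= pi * x by rewrite mulr_ge0// ltW.
  have pxy : pi * x < pi * y by rewrite ltr_pM2l.
  have py : pi * y < pi * 1 by rewrite ltr_pM2l.
  rewrite cos_gt0_pihalf; last by apply/andP; split; lra.
  by rewrite ltr_cos ?in_itv /=; [lra|apply/andP; split; lra..].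
have [a0 ab] : 0 < a /\ a < b.
  have /andP[? ?] := cd (d / 2) d ltac:(lra) ltac:(lra) d1.
  by split; [rewrite exprn_gt0|rewrite ltr_pXn2r// nnegrE ltW//; lra].
have b0 : 0 < b by exact: lt_trans ab.
(* The [N] extracted from this limit satisfies a^N < e (d/2) b^N. *)
have cvg0 : (fun N => 2 / d * (a / b) ^+ N) @ \oo --> (0 : R).
  rewrite -[0](mulr0 (2 / d)); apply: cvgMr; apply: cvg_expr.
  by rewrite ger0_norm ?divr_ge0 ?ltW// ltr_pdivrMr// mul1r.
have /cvgrPdist_lt/(_ _ e0)[N _ /(_ _ (leqnn N))] := cvg0.
rewrite /= sub0r normrN ger0_norm; last first.
  by rewrite mulr_ge0 ?exprn_ge0 ?divr_ge0 ?ltW.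
move=> ltNe; exists N.
have dF := @is_derive_kernel_primitive N.
have far : kernel_primitive N 1 - kernel_primitive N d <= a ^+ N.
  have [c /andP[dc c1] ->] := is_derive_MVT dF (ltW d1).
  apply: (@le_trans _ _ (cos (pi * c / 2) ^+ N.*2)).
    by rewrite ler_piMr -?muln2 ?exprM ?sqr_ge0//; lra.
  rewrite -mul2n !exprM; apply: lerXn2r; rewrite ?nnegrE ?sqr_ge0//.
  have cle x : 0 <= x -> x < 1 -> 0 <= cos (pi * x / 2).
    rewrite le_eqVlt => /predU1P[<- _|x0 x1]; first by rewrite mulr0 mul0r cos0.
    by have /andP[/ltW] := cd 0 x (lexx _) x0 x1.
  move: dc; rewrite le_eqVlt => /predU1P[<-|dc']; first by rewrite lexx.
  move: c1; rewrite le_eqVlt => /predU1P[->|c1].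
    by rewrite mulr1 cos_pihalf expr0n/=; exact: (ltW a0).
  have /andP[c0 cdd] := cd d c (ltW d0) dc' c1.
  apply: lerXn2r; last exact: ltW.
    by rewrite nnegrE ltW.
  by rewrite nnegrE cle// ltW.
have near : d / 2 * b ^+ N <= kernel_primitive N 1.
  have d20 : 0 <= d / 2 by lra.
  have [c /andP[c0 cd2]] := is_derive_MVT dF d20.
  rewrite kernel_primitive0 !subr0 => Fd2.
  apply: (@le_trans _ _ (kernel_primitive N (d / 2))); last first.
    by apply: kernel_primitive_le; lra.
  rewrite Fd2 mulrC ler_wpM2r// /b -exprM mul2n.
  have [->//|cd2'] := eqVneq c (d / 2).
  have cd2lt : c < d / 2 by rewrite lt_neqAle cd2'.
  have /andP[cd20 cd2c] := cd c (d / 2) c0 cd2lt ltac:(lra).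
  apply: lerXn2r; last exact: ltW.
    by rewrite nnegrE ltW.
  by rewrite nnegrE (ltW (lt_trans cd20 cd2c)).
rewrite kernel_primitive1 in far near.
have bN0 : 0 < b ^+ N by rewrite exprn_gt0.
have : a ^+ N <= e * central_bin N.
  apply: (@le_trans _ _ (e * (d / 2 * b ^+ N))); last by rewrite ler_pM2l.
  rewrite (_ : a ^+ N = 2 / d * (a / b) ^+ N * (d / 2 * b ^+ N)); last first.
    by rewrite expr_div_n; field; rewrite gt_eqF//= gt_eqF.
  by rewrite ler_pM2r ?(ltW ltNe)// mulr_gt0// divr_gt0.
lra.
Qed.

Lemma continuous_cos_expr n : continuous (fun u => cos (pi * u / 2) ^+ n).
Proof.
move=> u; apply: (@continuous_comp _ _ _ (fun u => cos (pi * u / 2)) (fun x => x ^+ n));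
  last exact: exprn_continuous.
apply: (@continuous_comp _ _ _ (fun u => pi * u / 2) cos); last exact: continuous_cos.
by apply: cvgMl; apply: cvgMr; exact: cvg_id.
Qed.

Lemma integral_cos_expr N :
  (\int[lebesgue_measure]_(u in `[(-1)%R, 1%R]) (cos (pi * u / 2) ^+ N.*2)%:E =
   (2 * central_bin N)%:E)%E.
Proof.
have dF := @is_derive_kernel_primitive N.
have cF := is_derive_continuous dF.
rewrite (@continuous_FTC2 _ (fun u => cos (pi * u / 2) ^+ N.*2) (kernel_primitive N)).
- by rewrite kernel_primitiveN kernel_primitive1 -EFinB opprK mulrDl mul1r.
- lra.
- by apply: continuous_subspaceT; exact: continuous_cos_expr.
- split => [u _||].
  + by case: (dF u).
  + exact/cvg_at_right_filter/cF.
  + exact/cvg_at_left_filter/cF.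
- by move=> u _; rewrite derive1E; exact: derive_val.
Qed.

(* Integrate [cos (pi u / 2) ^ 2N <= exp (- N pi^2 u^2 / 4)] over [-1, 1]. *)
Lemma central_bin_le N : (0 < N)%N -> central_bin N <= (Num.sqrt (pi * N%:R))^-1.
Proof.
move=> N0; have NR : 0 < N%:R :> R by rewrite ltr0n.
have p0 := @pi_gt0 R.
have pn0 : pi != 0 :> R by rewrite gt_eqF.
have Nn0 : N%:R != 0 :> R by rewrite gt_eqF.
have v0 : 0 < 2 / (pi ^+ 2 * N%:R) :> R by rewrite divr_gt0// mulr_gt0// exprn_gt0.
(* The bound exp (- N pi^2 u^2 / 4) is a Gaussian of variance s^2 = 2 / (pi^2 N), scaled by the
   inverse K = 2 / sqrt (pi N) of its peak. *)
pose s : R := Num.sqrt (2 / (pi ^+ 2 * N%:R)).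
have s2 : s ^+ 2 = 2 / (pi ^+ 2 * N%:R) by rewrite sqr_sqrtr// ltW.
have s0 : s != 0 by rewrite gt_eqF// sqrtr_gt0.
pose K : R := 2 / Num.sqrt (pi * N%:R).
have peakE : normal_peak s = K^-1.
  rewrite /normal_peak /K s2 (_ : 2 / _ * pi *+ 2 = 2 ^+ 2 * (pi * N%:R)^-1); last first.
    by rewrite mulr2n; move: pi pn0 => q q0; field; rewrite Nn0 q0.
  by rewrite sqrtrM ?sqr_ge0// sqrtr_sqr ger0_norm// sqrtrV// mulr_ge0// ltW.
have K0 : 0 < K by rewrite /K divr_gt0// sqrtr_gt0 mulr_gt0.
have bnd u : -1 <= u <= 1 -> cos (pi * u / 2) ^+ N.*2 <= K * normal_pdf 0 s u.
  move=> /andP[u1 u2]; rewrite normal_pdfE// peakE mulVKf ?gt_eqF//.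
  have pu : pi * u <= pi * 1 by rewrite ler_pM2l.
  have pu' : pi * (-1) <= pi * u by rewrite ler_pM2l.
  have c0 : 0 <= cos (pi * u / 2) by rewrite cos_ge0_pihalf//; lra.
  have := @cos_le_gauss R (pi * u / 2); rewrite ler_norml => cg.
  apply: (@le_trans _ _ (expR (- ((pi * u / 2) ^+ 2 / 2)) ^+ N.*2)).
    by apply: lerXn2r; rewrite ?nnegrE ?expR_ge0// cg//; lra.
  rewrite -expRM_natr /normal_fun subr0 s2 ler_expR le_eqVlt; apply/orP; left.
  apply/eqP; rewrite -muln2 natrM.
  by move: pi pn0 => q q0; field; rewrite Nn0 q0.
have mc : measurable_fun setT (fun u => cos (pi * u / 2) ^+ N.*2).
  by apply: continuous_measurable_fun; exact: continuous_cos_expr.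
have mK : measurable_fun setT (fun u => K * normal_pdf 0 s u).
  by apply: measurable_funM => //; exact: measurable_normal_pdf.
have : ((2 * central_bin N)%:E <= K%:E)%E.
  rewrite -integral_cos_expr.
  apply: (@le_trans _ _
    (\int[lebesgue_measure]_(u in `[(-1)%R, 1%R]) (K * normal_pdf 0 s u)%:E)%E).
    apply: ge0_le_integral => //=.
    - by move=> u _; rewrite lee_fin -muln2 exprM sqr_ge0.
    - by apply: measurable_funTS; apply/measurable_EFinP; exact: mc.
    - by apply: measurable_funTS; exact/measurable_EFinP.
  apply: (@le_trans _ _ (\int[lebesgue_measure]_u (K * normal_pdf 0 s u)%:E)%E).
    apply: ge0_subset_integral => //=.
      exact/measurable_EFinP.
    by move=> u _; rewrite lee_fin mulr_ge0 ?normal_pdf_ge0// ltW.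
  under eq_integral do rewrite EFinM.
  rewrite ge0_integralZl_EFin//= ?integral_normal_pdf ?mule1// 1?ltW//.
    by move=> u _; rewrite lee_fin normal_pdf_ge0.
  by apply/measurable_EFinP; exact: measurable_normal_pdf.
by rewrite lee_fin /K ler_pM2l.
Qed.

End kernel.
(** * Lebesgue integrals on the line *)

Section affine_change_of_variables.
Context {R : realType}.
Local Notation mu := (@lebesgue_measure R).
Implicit Types (a b : R).

Lemma measurable_affine a b : measurable_fun setT (fun x : R => a * x + b).
Proof. by apply: measurable_funD => //; exact: measurable_funM. Qed.

Lemma preimage_affine_ocitv a b u v : 0 < a ->
  (fun x : R => a * x + b) @^-1` `]u, v] = `](u - b) / a, (v - b) / a]%classic.
Proof.
move=> a0; apply/seteqP; split => x /=; rewrite !in_itv/=;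
  by rewrite ler_pdivlMr// ltr_pdivrMr// ltrBlDr lerBrDr mulrC.
Qed.

(** The right-hand side is a measure in [A] that gives half-open intervals their length, so
    uniqueness of Lebesgue measure applies. *)
Lemma lebesgue_measure_affine a b (A : set R) : 0 < a -> measurable A ->
  mu A = (a%:E * mu ((fun x => a * x + b)%R @^-1` A))%E.
Proof.
move=> a0; pose k : {nonneg R} := NngNum (ltW a0).
have mphi : measurable_fun setT
    ((fun x => a * x + b) : measurableTypeR R -> measurableTypeR R).
  exact: measurable_affine.
(* The measure instance of the image of mu depends on the proof mphi, hence
   cannot be inferred. *)
pose m := measure_function_pushforward__canonical__measure_function_Measure mu mphi.
move: A; apply: (@lebesgue_measure_unique R (mscale k m)).
move=> _ [[u v] _ <-].
suff: mu `]u, v] = (a%:E * mu ((fun x => a * x + b)%R @^-1` `]u, v]))%E by [].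
have -> := preimage_affine_ocitv b u v a0; rewrite !lebesgue_measure_itv/= !lte_fin.
rewrite ltr_pM2r ?invr_gt0// ltrD2r; case: ifP => uv; last by rewrite mule0.
by rewrite -!EFinB -EFinM; congr EFin; field; rewrite gt_eqF.
Qed.

Lemma ge0_integral_affine a b (f : R -> \bar R) : 0 < a ->
  measurable_fun setT f -> (forall x, 0 <= f x)%E ->
  (\int[mu]_x f x = a%:E * \int[mu]_x f (a * x + b)%R)%E.
Proof.
move=> a0 mf f0; pose k : {nonneg R} := NngNum (ltW a0).
have mphi : measurable_fun setT
    ((fun x => a * x + b) : measurableTypeR R -> measurableTypeR R).
  exact: measurable_affine.
pose m : {measure set (measurableTypeR R) -> \bar R} :=
  measure_function_pushforward__canonical__measure_function_Measure mu mphi.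
transitivity (\int[mscale k m]_x f x)%E.
  apply: (eq_measure_integral (mscale k m)) => A mA _.
  exact: lebesgue_measure_affine.
rewrite ge0_integral_mscale//; congr (_ * _)%E.
by rewrite [LHS](ge0_integral_pushforward mphi)// preimage_setT.
Qed.

Lemma integral_affine a b (f : R -> \bar R) : 0 < a -> measurable_fun setT f ->
  (\int[mu]_x f x = \int[mu]_x (a%:E * f (a * x + b)%R))%E.
Proof.
move=> a0 mf; rewrite integralE [RHS]integralE.
have mfa : measurable_fun setT (fun x => f (a * x + b)).
  by apply: (measurableT_comp mf); exact: measurable_affine.
rewrite (ge0_integral_affine b a0 (measurable_funepos mf))//.
rewrite (ge0_integral_affine b a0 (measurable_funeneg mf))//.
rewrite -!ge0_integralZl//=; last 4 first.
- by apply: (measurableT_comp (measurable_funeneg mf)); exact: measurable_affine.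
- by rewrite lee_fin ltW.
- by apply: (measurableT_comp (measurable_funepos mf)); exact: measurable_affine.
- by rewrite lee_fin ltW.
congr (_ - _)%E; apply: eq_integral => x _.
  by rewrite (ge0_funeposM (fun x => f (a * x + b)) (ltW a0)) !funeposE.
by rewrite (ge0_funenegM (fun x => f (a * x + b)) (ltW a0)) !funenegE.
Qed.

End affine_change_of_variables.

(** * Integrability on the whole line and self-adjointness of the walk *)

Section real_integrals.
Context {R : realType}.
Local Notation mu := (@lebesgue_measure R).
Implicit Types (f g : R -> R) (a b k : R).

Local Notation integrable f := (mu.-integrable setT (EFin \o f)).

Lemma integrable_measurable f : integrable f -> measurable_fun setT f.
Proof. by move=> /measurable_int /measurable_EFinP. Qed.

Lemma measurable_cosM (t : R) : measurable_fun setT (fun x : R => cos (t * x)).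
Proof.
have m := continuous_measurable_fun (@continuous_cos R).
by apply: (measurableT_comp m); exact: measurable_funM.
Qed.

Lemma measurable_sinM (t : R) : measurable_fun setT (fun x : R => sin (t * x)).
Proof.
have m := continuous_measurable_fun (@continuous_sin R).
by apply: (measurableT_comp m); exact: measurable_funM.
Qed.

Lemma Rintegral_shift f b : measurable_fun setT f ->
  \int[mu]_x f (x + b) = \int[mu]_x f x.
Proof.
move=> mf; rewrite /Rintegral [in RHS](integral_affine b ltr01);
  last exact/measurable_EFinP.
by congr fine; apply: eq_integral => x _; rewrite mul1e mul1r.
Qed.

Lemma integrable_affine f a b : 0 < a -> integrable f ->
  integrable (fun x => f (a * x + b)).
Proof.
move=> a0 /integrableP[mf fi]; apply/integrableP; split.
  by apply: (measurableT_comp mf); exact: measurable_affine.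
move: fi; rewrite (ge0_integral_affine b a0)//; last exact: measurableT_comp.
move=> fi; rewrite -(@lte_pmul2l _ a%:E)//.
by rewrite mulry gtr0_sg// mul1e.
Qed.

Lemma integrable_shift f b : integrable f -> integrable (fun x => f (x + b)).
Proof.
move=> /(integrable_affine b ltr01); apply: eq_integrable => // x _ /=.
by rewrite mul1r.
Qed.

Lemma Rintegral_scale f a : 0 < a -> integrable f ->
  a * \int[mu]_x f (a * x) = \int[mu]_x f x.
Proof.
move=> a0 fi; have fa := integrable_affine 0 a0 fi.
rewrite -RintegralZl//; last by apply: eq_integrable fa => // x _ /=; rewrite addr0.
rewrite /Rintegral [in RHS](integral_affine 0 a0).
  by congr fine; apply: eq_integral => x _; rewrite /= addr0.
by apply/measurable_EFinP; exact: integrable_measurable.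
Qed.

Lemma integrable_mul_bounded f g k : integrable f -> measurable_fun setT g ->
  (forall x, `|g x| <= k) -> integrable (fun x => f x * g x).
Proof.
move=> fi mg gk.
have : mu.-integrable setT ((EFin \o f) \* (EFin \o g))%E.
  apply: integrableMl => //; exists k; split; first exact: num_real.
  by move=> y ky x _; rewrite /= (le_trans (gk x))// ltW.
by apply: eq_integrable.
Qed.

Lemma integrable_add f g : integrable f -> integrable g ->
  integrable (fun x => f x + g x).
Proof.
move=> fi gi; have := integrableD measurableT fi gi.
by apply: eq_integrable => // x _ /=; rewrite EFinD.
Qed.

Lemma integrable_scale f a : integrable f -> integrable (fun x => a * f x).
Proof.
move=> fi; have := integrableZl measurableT a fi.
by apply: eq_integrable => // x _ /=; rewrite EFinM.
Qed.

Lemma integrable_sub f g : integrable f -> integrable g ->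
  integrable (fun x => f x - g x).
Proof.
move=> fi gi; apply: integrable_add => //.
by apply: eq_integrable (integrable_scale (-1) gi) => // x _ /=; rewrite mulN1r.
Qed.

Lemma integrable_walk f : integrable f -> integrable (walk f).
Proof.
move=> fi.
have := integrable_add (integrable_shift 1 fi) (integrable_shift (-1) fi).
move=> /(integrable_scale 2^-1); apply: eq_integrable => // x _ /=.
by rewrite /walk mulrC.
Qed.

Lemma integrable_iter_walk n f : integrable f -> integrable (iter n walk f).
Proof. by move=> fi; elim: n => [//|n IH]; exact: integrable_walk. Qed.

Lemma walk_norm_le g k :
  (forall x, `|g x| <= k) -> forall x, `|walk g x| <= k.
Proof. exact: (@iter_walk_norm_le R 1). Qed.

(** Translation by b has translation by -b as adjoint, and [walk] averages the translations by 1 and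
    -1. *)
Lemma Rintegral_walk f g k : integrable f -> measurable_fun setT g ->
  (forall x, `|g x| <= k) ->
  \int[mu]_x (walk f x * g x) = \int[mu]_x (f x * walk g x).
Proof.
move=> fi mg gk; have mf := integrable_measurable fi.
have mgs b : measurable_fun setT (fun x : R => g (x + b)).
  by apply: (measurableT_comp mg); exact: measurable_funD.
have i1 b : integrable (fun x => f (x + b) * g x).
  by apply: (@integrable_mul_bounded _ _ k) => //; exact: integrable_shift.
have i2 b : integrable (fun x => f x * g (x + b)).
  by apply: (@integrable_mul_bounded _ _ k).
have sh b : \int[mu]_x (f (x + b) * g x) = \int[mu]_x (f x * g (x - b)).
  rewrite -[RHS](Rintegral_shift b); last exact: measurable_funM.
  by apply: eq_Rintegral => x _; rewrite addrK.
transitivity (2^-1 * (\int[mu]_x (f (x + 1) * g x) + \int[mu]_x (f (x - 1) * g x))).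
  rewrite -RintegralD// -RintegralZl//; last exact: integrable_add.
  by apply: eq_Rintegral => x _; rewrite /walk; field.
rewrite !sh opprK addrC -RintegralD// -RintegralZl//; last exact: integrable_add.
by apply: eq_Rintegral => x _; rewrite /walk; field.
Qed.

Lemma Rintegral_iter_walk n f g k : integrable f -> measurable_fun setT g ->
  (forall x, `|g x| <= k) ->
  \int[mu]_x (iter n walk f x * g x) = \int[mu]_x (f x * iter n walk g x).
Proof.
elim: n g => [//|n IH] g fi mg gk.
rewrite (Rintegral_walk (integrable_iter_walk n fi) mg gk) IH//; last 2 first.
- exact: measurable_walk.
- exact: walk_norm_le gk.
by apply: eq_Rintegral => x _; rewrite -iterSr.
Qed.

End real_integrals.
(** * Convergence in L2 of the walk densities *)

Section limits.
Context {R : realType}.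
Local Notation mu := (@lebesgue_measure R).
Implicit Types (p c f g : R -> R) (n : nat).

Local Notation integrable f := (mu.-integrable setT (EFin \o f)).

Lemma EFin_Rintegral f : integrable f ->
  (\int[mu]_x f x)%:E = (\int[mu]_x (f x)%:E)%E.
Proof. by move=> fi; rewrite /Rintegral fineK// integrable_fin_num. Qed.

Lemma cvg_sqrt_natV : (fun n => (Num.sqrt n%:R)^-1 : R) @ \oo --> (0 : R).
Proof.
apply/cvgrPdist_lt => e e0; near=> n.
have n0 : 0 < n%:R :> R by near: n; exact: nbhs_infty_gtr.
rewrite sub0r normrN ger0_norm ?invr_ge0 ?sqrtr_ge0//.
rewrite -[e]invrK ltf_pV2 ?posrE ?invr_gt0 ?sqrtr_gt0//.
rewrite -[ltLHS](@ger0_norm _ (e^-1)) ?invr_ge0 1?ltW// -sqrtr_sqr ltr_sqrt//.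
by near: n; exact: nbhs_infty_gtr.
Unshelve. all: by end_near. Qed.

(** This is Phi_n; both the starting profile and the number of steps depend on n. *)
Definition walk_pdf n := iter n walk (@scaled_pdf R n).

Lemma walk_pdf_ge0 n x : 0 <= walk_pdf n x.
Proof. by apply: iter_walk_ge0 => y; exact: scaled_pdf_ge0. Qed.

Lemma walk_pdf_le1 n x : walk_pdf n x <= 1.
Proof. by apply: iter_walk_le => y; exact: scaled_pdf_le1. Qed.

Lemma walk_pdf_norm_le1 n x : `|walk_pdf n x| <= 1.
Proof. by rewrite ger0_norm ?walk_pdf_ge0 ?walk_pdf_le1. Qed.

Lemma measurable_walk_pdf n : measurable_fun setT (walk_pdf n).
Proof. by apply: measurable_iter_walk; exact: measurable_scaled_pdf. Qed.

(** Phi_n has Lipschitz constant 1 / sqrt n, so Phi_n(x) - Phi_n(0) tends to 0 at each x. It is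
    bounded by 1, so dominated convergence applies with dominating function |p|. *)
Lemma cvg_Rintegral_walk_pdf p c : integrable p -> measurable_fun setT c ->
  (forall x, `|c x| <= 1) ->
  (fun n => \int[mu]_x (p x * (c x * walk_pdf n x)) -
            walk_pdf n 0 * \int[mu]_x (p x * c x)) @ \oo --> (0 : R).
Proof.
move=> pi mc c1; have mp := integrable_measurable pi.
pose h n x := p x * c x * (walk_pdf n x - walk_pdf n 0).
have pci : integrable (fun x => p x * c x) by exact: integrable_mul_bounded c1.
have d1 n x : `|walk_pdf n x - walk_pdf n 0| <= 1.
  have := walk_pdf_ge0 n x; have := walk_pdf_le1 n x.
  have := walk_pdf_ge0 n 0; have := walk_pdf_le1 n 0.
  by rewrite ler_norml; lra.
have mh n : measurable_fun setT (h n).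
  apply: measurable_funM; first exact: measurable_funM.
  by apply: measurable_funB => //; exact: measurable_walk_pdf.
have -> : (fun n => \int[mu]_x (p x * (c x * walk_pdf n x)) -
            walk_pdf n 0 * \int[mu]_x (p x * c x)) = (fun n => \int[mu]_x h n x).
  apply/funext => n; rewrite -RintegralZl// -RintegralB//.
  - by apply: eq_Rintegral => x _; rewrite /h; ring.
  - have := integrable_mul_bounded pci (@measurable_walk_pdf n) (walk_pdf_norm_le1 n).
    by apply: eq_integrable => // x _ /=; rewrite mulrA.
  - exact: integrable_scale.
have := @dominated_convergence _ _ _ mu setT measurableT
  (fun n x => (h n x)%:E) (cst 0%E) (fun x => `|p x|%:E).
case.
- by move=> n; apply/measurable_EFinP; exact: mh.
- exact: measurable_cst.
- apply: aeW => x _; apply/fine_cvgP; split; first exact: nearW.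
  apply/norm_cvg0P; apply: (@squeeze_cvgr _ _ _ _ (cst 0)
    (fun n => `|p x| * `|x| * (Num.sqrt n%:R)^-1)).
  (* The bound holds at n = 0 too: with 0^-1 = 0 the profile [scaled_pdf 0] is constant. *)
  + apply: nearW => n /=; rewrite normr_ge0 /h !normrM -!mulrA.
    rewrite ler_wpM2l// -[leRHS]mul1r ler_pM// [leRHS]mulrC.
    by have := iter_walk_scaled_pdf_lipschitz n x 0; rewrite subr0.
  + exact: cvg_cst.
  + rewrite -[0](mulr0 (`|p x| * `|x|)); apply: cvgMr; exact: cvg_sqrt_natV.
- exact: integrable_norm pi.
- apply: aeW => x n _; rewrite lee_fin /h !normrM -mulrA ler_piMr//.
  by rewrite mulr_ile1.
by move=> _ _; rewrite integral0 -[0%E]/(0%R%:E) => /fine_cvgP[_].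
Qed.

(** The square of the standard normal density is a multiple of the normal density of variance
    1/2. *)
Lemma Rintegral_sqr_normal_pdf :
  integrable (fun x => normal_pdf 0 1 x ^+ 2) /\
  \int[mu]_x normal_pdf 0 1 x ^+ 2 = (2 * Num.sqrt pi)^-1.
Proof.
pose s : R := Num.sqrt 2^-1.
have s2 : s ^+ 2 = 2^-1 by rewrite sqr_sqrtr// invr_ge0.
have s0 : s != 0 by rewrite gt_eqF// sqrtr_gt0 invr_gt0.
have sp0 : Num.sqrt pi != 0 :> R by rewrite gt_eqF// sqrtr_gt0 pi_gt0.
have E x : normal_pdf 0 1 x ^+ 2 = (2 * Num.sqrt pi)^-1 * normal_pdf 0 s x.
  rewrite normal_pdf01E normal_pdfE// /normal_peak /normal_fun subr0 s2.
  rewrite exprMn exprVn sqr_sqrtr ?mulr1 ?mulr_ge0 ?pi_ge0// -expRM_natr.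
  rewrite (_ : 2^-1 * pi *+ 2 = pi); last by rewrite mulr2n; field.
  rewrite (_ : 2^-1 *+ 2 = 1); last by rewrite mulr2n; field.
  rewrite [RHS]mulrA -invfM -[in RHS]mulrA -[in RHS]expr2 sqr_sqrtr ?pi_ge0//.
  by congr (_ * expR _); field.
have iE : integrable (normal_pdf 0 s) := integrable_normal_pdf 0 s.
split.
  have := integrable_scale (2 * Num.sqrt pi)^-1 iE.
  by apply: eq_integrable => // x _ /=; rewrite E.
rewrite (@eq_Rintegral _ _ _ mu setT
  (fun x => (2 * Num.sqrt pi)^-1 * normal_pdf 0 s x)); last first.
  by move=> x _; exact: E.
by rewrite RintegralZl// /Rintegral integral_normal_pdf mulr1.
Qed.

(** This is q_n; [has_density_norm_sum] identifies it as a density of Z_n. *)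
Definition walk_density p n x := Num.sqrt n%:R * iter n walk p (Num.sqrt n%:R * x).

Lemma integrable_walk_density p n : (0 < n)%N -> integrable p ->
  integrable (walk_density p n).
Proof.
move=> n0 ip; have r0 : 0 < Num.sqrt n%:R :> R by rewrite sqrtr_gt0 ltr0n.
have := integrable_affine 0 r0 (integrable_iter_walk n ip).
move=> /(integrable_scale (Num.sqrt n%:R)).
by apply: eq_integrable => // x _ /=; rewrite addr0.
Qed.

(** Rescaling the variable absorbs the factor sqrt n and turns [normal_pdf] into [scaled_pdf];
    self-adjointness then moves the n steps onto the test function. Taking [c] at sqrt n * x keeps
    its period fixed on the unscaled line. *)
Lemma Rintegral_walk_density p c n : (0 < n)%N -> integrable p ->
  measurable_fun setT c -> (forall x, `|c x| <= 1) ->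
  \int[mu]_x (walk_density p n x * (c (Num.sqrt n%:R * x) * normal_pdf 0 1 x)) =
  \int[mu]_x (p x * iter n walk (fun x => c x * scaled_pdf n x) x).
Proof.
move=> n0 ip mc c1; have r0 : 0 < Num.sqrt n%:R :> R by rewrite sqrtr_gt0 ltr0n.
have mcs : measurable_fun setT (fun x => c x * scaled_pdf n x).
  by apply: measurable_funM => //; exact: measurable_scaled_pdf.
have bcs x : `|c x * scaled_pdf n x| <= 1.
  by rewrite normrM mulr_ile1// ger0_norm ?scaled_pdf_ge0 ?scaled_pdf_le1.
rewrite -(Rintegral_iter_walk n ip mcs bcs).
have iW := integrable_mul_bounded (integrable_iter_walk n ip) mcs bcs.
rewrite -(Rintegral_scale r0 iW) -RintegralZl//.
  apply: eq_Rintegral => x _.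
  by rewrite /walk_density /scaled_pdf (mulrC (Num.sqrt _) x) mulfK ?gt_eqF//; ring.
by apply: eq_integrable (integrable_affine 0 r0 iW) => // x _ /=; rewrite addr0.
Qed.

(** * L2 convergence for densities whose periodization is at most 1/2 *)

Section half_bounded_density.
Variable p : R -> R.
Hypotheses (ip : integrable p) (p0 : forall x, 0 <= p x) (p2 : forall x, p x <= 2^-1).
Hypothesis (p1 : \int[mu]_x p x = 1).
Hypothesis periodization_le : forall n, {ae mu, forall x,
  \sum_(j < n.*2.+1) p (x + 2 * (n%:R - j%:R)) <= 2^-1}.

Let mp : measurable_fun setT p. Proof. exact: integrable_measurable. Qed.

Let Wp0 n x : 0 <= iter n walk p x. Proof. exact: iter_walk_ge0. Qed.

Let Wp2 n x : `|iter n walk p x| <= 2^-1.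
Proof. by rewrite ger0_norm//; exact: iter_walk_le. Qed.

(** After 2n steps all displacements are even. Bounding each binomial weight by the central one
    leaves a partial sum of the periodization with period 2. *)
Lemma iter_walk_ae_le n :
  {ae mu, forall x, iter n.*2 walk p x <= @central_bin R n / 2}.
Proof.
apply: (@filterS _ _ (ae_filter_ringOfSetsType mu) _ _ _ (periodization_le n)) => x /= h.
rewrite iter_walkE; apply: le_trans (_ : @central_bin R n *
   \sum_(j < n.*2.+1) p (x + 2 * (n%:R - j%:R)) <= _); last first.
  by rewrite ler_wpM2l //= ltW ?central_bin_gt0.
rewrite big_distrr /=; apply: ler_sum => j _.
rewrite (_ : n.*2%:R - 2 * j%:R = 2 * (n%:R - j%:R)); last first.
  by rewrite mulrBr (_ : n.*2%:R = 2 * n%:R)// -natrM mul2n.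
by rewrite ler_wpM2r// ler_wpM2r ?invr_ge0 ?exprn_ge0// ler_nat leq_bin_central.
Qed.

Lemma Rintegral_sqr_iter_walk_le n :
  integrable (fun x => iter n walk p x ^+ 2) /\
  \int[mu]_x iter n walk p x ^+ 2 <= @central_bin R n / 2.
Proof.
have i2 : integrable (fun x => iter n walk p x * iter n walk p x).
  apply: (integrable_mul_bounded _ _ (Wp2 n)); first exact: integrable_iter_walk.
  exact: measurable_iter_walk.
split; first by apply: eq_integrable i2.
rewrite (@eq_Rintegral _ _ _ mu setT
  (fun x => iter n walk p x * iter n walk p x)); last first.
  by move=> x _; rewrite expr2.
rewrite (Rintegral_iter_walk n ip (measurable_iter_walk n mp) (Wp2 n)).
rewrite (@eq_Rintegral _ _ _ mu setT (fun x => p x * iter n.*2 walk p x)); last first.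
  by move=> x _; rewrite -iterD addnn.
have iL : integrable (fun x => p x * iter n.*2 walk p x).
  by apply: (integrable_mul_bounded _ _ (Wp2 n.*2)) => //; exact: measurable_iter_walk.
rewrite -lee_fin EFin_Rintegral//.
have -> : @central_bin R n / 2 = \int[mu]_x (@central_bin R n / 2 * p x).
  by rewrite RintegralZl// p1 mulr1.
rewrite EFin_Rintegral; last exact: integrable_scale.
apply: ae_ge0_le_integral => //.
- by move=> x _; rewrite lee_fin mulr_ge0.
- by case/integrableP : iL.
- move=> x _; rewrite lee_fin mulr_ge0// mulr_ge0 ?invr_ge0// ltW//.
  exact: central_bin_gt0.
- by case/integrableP : (integrable_scale (@central_bin R n / 2) ip).
- apply: (@filterS _ _ (ae_filter_ringOfSetsType mu) _ _ _ (iter_walk_ae_le n)) => x h _.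
  by rewrite lee_fin mulrC ler_wpM2r.
Qed.

Lemma Rintegral_sqr_walk_density_le n : (0 < n)%N ->
  integrable (fun x => walk_density p n x ^+ 2) /\
  \int[mu]_x walk_density p n x ^+ 2 <= (2 * Num.sqrt pi)^-1.
Proof.
move=> n0; have r0 : 0 < Num.sqrt n%:R :> R by rewrite sqrtr_gt0 ltr0n.
have [iW leW] := Rintegral_sqr_iter_walk_le n.
have iWs : integrable (fun x => iter n walk p (Num.sqrt n%:R * x) ^+ 2).
  by apply: eq_integrable (integrable_affine 0 r0 iW) => // x _ /=; rewrite addr0.
have E x : walk_density p n x ^+ 2 =
    n%:R * iter n walk p (Num.sqrt n%:R * x) ^+ 2.
  by rewrite exprMn sqr_sqrtr.
split.
  by apply: eq_integrable (integrable_scale n%:R iWs) => // x _ /=; rewrite E.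
rewrite (@eq_Rintegral _ _ _ mu setT
  (fun x => n%:R * iter n walk p (Num.sqrt n%:R * x) ^+ 2)); last first.
  by move=> x _; exact: E.
rewrite RintegralZl// -{1}(@sqr_sqrtr _ n%:R)// expr2 -mulrA (Rintegral_scale r0 iW).
apply: (@le_trans _ _ (Num.sqrt n%:R * ((Num.sqrt (pi * n%:R))^-1 / 2))).
  rewrite ler_pM2l//; apply: (le_trans leW).
  by rewrite ler_pM2r ?invr_gt0//; exact: central_bin_le.
rewrite sqrtrM ?pi_ge0// le_eqVlt; apply/orP; left; apply/eqP.
by field; rewrite !gt_eqF// sqrtr_gt0 pi_gt0.
Qed.

Let one_le1 (x : R) : `|cst 1 x : R| <= 1. Proof. by rewrite /= normr1. Qed.

Lemma Rintegral_walk_density_pdf n : (0 < n)%N ->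
  \int[mu]_x (walk_density p n x * normal_pdf 0 1 x) =
  \int[mu]_x (p x * (cst 1 x * walk_pdf n x)).
Proof.
move=> n0; have := Rintegral_walk_density n0 ip (measurable_cst (1 : R)) one_le1.
under eq_Rintegral do rewrite mul1r.
move=> ->; apply: eq_Rintegral => x _; rewrite /= mul1r; congr (_ * _).
by apply: (@congr1 _ _ (fun g => iter n walk g x)); apply/funext => y; rewrite mul1r.
Qed.

Let pdf_le1 x : `|normal_pdf 0 1 x : R| <= 1.
Proof.
by rewrite normal_pdf01E ger0_norm ?gauss_density_ge0 ?gauss_density_le1.
Qed.

(** Expand the square: both pure terms are at most 1 / (2 sqrt pi), so only the cross term, equal to
    int p Phi_n, needs a lower bound. *)
Lemma Rintegral_sqr_walk_density_sub n : (0 < n)%N ->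
  integrable (fun x => (walk_density p n x - normal_pdf 0 1 x) ^+ 2) /\
  \int[mu]_x (walk_density p n x - normal_pdf 0 1 x) ^+ 2 <=
  2 * ((2 * Num.sqrt pi)^-1 - \int[mu]_x (p x * (cst 1 x * walk_pdf n x))).
Proof.
move=> n0; have [iq leq] := Rintegral_sqr_walk_density_le n0.
have [iN eN] := Rintegral_sqr_normal_pdf.
have iqN : integrable (fun x => walk_density p n x * normal_pdf 0 1 x).
  apply: (integrable_mul_bounded _ _ pdf_le1); first exact: integrable_walk_density.
  exact: measurable_normal_pdf.
have i2 := integrable_sub (integrable_add iq iN) (integrable_scale 2 iqN).
have E x : (walk_density p n x - normal_pdf 0 1 x) ^+ 2 =
    walk_density p n x ^+ 2 + normal_pdf 0 1 x ^+ 2 -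
    2 * (walk_density p n x * normal_pdf 0 1 x) by ring.
split; first by apply: eq_integrable i2 => // x _ /=; rewrite E.
under eq_Rintegral do rewrite E.
rewrite RintegralB//; [|exact: integrable_add|exact: integrable_scale].
rewrite RintegralD// RintegralZl// eN -Rintegral_walk_density_pdf//.
lra.
Qed.

Lemma cvg_walk_density :
  (fun n => \int[mu]_x (walk_density p n x - normal_pdf 0 1 x) ^+ 2) @ \oo --> (0 : R).
Proof.
pose e n := \int[mu]_x (p x * (cst 1 x * walk_pdf n x)) -
            walk_pdf n 0 * \int[mu]_x (p x * cst 1 x).
have e0 : e @ \oo --> (0 : R).
  exact: (cvg_Rintegral_walk_pdf ip (measurable_cst (1 : R)) one_le1).
have p11 : \int[mu]_x (p x * cst 1 x) = 1.
  by rewrite -[RHS]p1; apply: eq_Rintegral => x _; rewrite mulr1.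
(* Twice the error 5/n of [iter_walk_scaled_pdf_ge], with 1/n written as a product of two 1 / sqrt
   n. *)
apply: (@squeeze_cvgr _ _ _ _ (cst 0)
  (fun n => 10 * ((Num.sqrt n%:R)^-1 * (Num.sqrt n%:R)^-1) - 2 * e n)).
- near=> n; have n0 : (0 < n)%N by near: n; exact: nbhs_infty_gt.
  rewrite /= Rintegral_ge0 => [|x _]; last exact: sqr_ge0.
  have [_ le1] := Rintegral_sqr_walk_density_sub n0.
  apply: (le_trans le1); have := @iter_walk_scaled_pdf_ge R _ n0.
  rewrite /e p11 mulr1 -/(walk_pdf n) -invfM -expr2 sqr_sqrtr// => h; lra.
- exact: cvg_cst.
- have -> : 0 = 10 * (0 * 0) - 2 * 0 :> R by ring.
  by apply: cvgB; apply: cvgMr => //; apply: cvgM; exact: cvg_sqrt_natV.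
Unshelve. all: by end_near. Qed.

End half_bounded_density.

End limits.
(** * Periodization *)

Section periodization.
Context {R : realType}.
Local Notation mu := (@lebesgue_measure R).
Local Notation integrable f := (mu.-integrable setT (EFin \o f)).

Lemma integrable_big_sum (I : Type) (s : seq I) (f : I -> R -> R) :
  (forall i, integrable (f i)) -> integrable (fun x => \sum_(i <- s) f i x).
Proof.
move=> fi; elim: s => [|i s IH].
  by apply: eq_integrable (integrable0 _ _) => // x _ /=; rewrite big_nil.
by apply: eq_integrable (integrable_add (fi i) IH) => // x _ /=; rewrite big_cons.
Qed.

Lemma Rintegral_big_sum (I : Type) (s : seq I) (f : I -> R -> R) :
  (forall i, integrable (f i)) ->
  \int[mu]_x (\sum_(i <- s) f i x) = \sum_(i <- s) \int[mu]_x f i x.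
Proof.
move=> fi; elim: s => [|i s IH].
  rewrite big_nil; under eq_Rintegral do rewrite big_nil.
  by rewrite /Rintegral integral0.
rewrite big_cons -IH -RintegralD//; last exact: integrable_big_sum.
by apply: eq_Rintegral => x _; rewrite big_cons.
Qed.

Variable p : R -> R.
Hypotheses (ip : integrable p) (p0 : forall x, 0 <= p x).
Hypothesis (p1 : \int[mu]_x p x = 1).
Hypothesis Pcos : forall k : int, k != 0 -> \int[mu]_x (p x * cos (pi * k%:~R * x)) = 0.
Hypothesis Psin : forall k : int, k != 0 -> \int[mu]_x (p x * sin (pi * k%:~R * x)) = 0.

Let pcosi (t : R) : integrable (fun x => p x * cos (t * x)).
Proof.
apply: (@integrable_mul_bounded _ _ _ 1) => //; first exact: measurable_cosM.
by move=> x; exact: cos_max.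
Qed.

Let psini (t : R) : integrable (fun x => p x * sin (t * x)).
Proof.
apply: (@integrable_mul_bounded _ _ _ 1) => //; first exact: measurable_sinM.
by move=> x; exact: sin_max.
Qed.

(** For k != 0 the difference is a combination of cos (pi k x) and sin (pi k x), whose integrals
    against p vanish; for k = 0 it is the constant b - a. *)
Lemma integral_sin_primitive k a b :
  integrable (fun x => p x * (sin_primitive k (x - a) - sin_primitive k (x - b))) /\
  \int[mu]_x (p x * (sin_primitive k (x - a) - sin_primitive k (x - b))) =
  (k == 0)%:R * (b - a).
Proof.
rewrite /sin_primitive; have [_|k0] := eqVneq k 0.
  have E x : p x * (x - a - (x - b)) = (b - a) * p x by ring.
  split.
    by apply: eq_integrable (integrable_scale (b - a) ip) => // x _ /=; rewrite E.
  by under eq_Rintegral do rewrite E; rewrite RintegralZl// p1 mulr1 mul1r.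
set t := pi * k%:~R.
pose u := (cos (t * a) - cos (t * b)) / t.
pose v := (sin (t * b) - sin (t * a)) / t.
have E x : p x * (sin (t * (x - a)) / t - sin (t * (x - b)) / t) =
    u * (p x * sin (t * x)) + v * (p x * cos (t * x)).
  by rewrite !mulrBr !sinB /u /v; ring.
have iu := integrable_scale u (psini t); have iv := integrable_scale v (pcosi t).
split; first by apply: eq_integrable (integrable_add iu iv) => // x _ /=; rewrite E.
under eq_Rintegral do rewrite E.
by rewrite RintegralD// !RintegralZl// Pcos// Psin// !mulr0 addr0 mul0r.
Qed.

(** The difference of primitives is the kernel at x - z integrated over z in [a, b]. As all nonzero
    frequencies vanish against p, the answer is the one for the uniform law modulo 2. *)
Lemma integral_kernel_primitive N a b :
  integrable (fun x => p x * (kernel_primitive N (x - a) - kernel_primitive N (x - b))) /\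
  \int[mu]_x (p x * (kernel_primitive N (x - a) - kernel_primitive N (x - b))) =
  central_bin N * (b - a).
Proof.
pose f (j : 'I_N.*2.+1) x := 'C(N.*2, j)%:R / 2 ^+ N.*2 * (p x *
  (sin_primitive (N%:Z - j%:Z) (x - a) - sin_primitive (N%:Z - j%:Z) (x - b))).
have fi j : integrable (f j) by exact/integrable_scale/(integral_sin_primitive _ _ _).1.
have E x : p x * (kernel_primitive N (x - a) - kernel_primitive N (x - b)) =
    \sum_j f j x.
  rewrite /kernel_primitive -sumrB mulr_sumr; apply: eq_bigr => j _.
  by rewrite /f; ring.
split.
  by apply: eq_integrable (integrable_big_sum (index_enum _) fi) => // x _ /=; rewrite E.
under eq_Rintegral do rewrite E.
rewrite Rintegral_big_sum// -central_coef_sum; apply: eq_bigr => j _.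
have [h1 h2] := integral_sin_primitive (N%:Z - j%:Z) a b.
by rewrite RintegralZl// h2.
Qed.

Section ball_bound.
Variables (n : nat) (y r : R).
Hypothesis r01 : 0 < r < 2^-1.

Let shift (j : nat) : R := 2 * (n%:R - j%:R).

(** Counts the translates of x by these even integers that lie in the ball. The shifts are at least
    2 apart and 2r < 1, so the count is 0 or 1. *)
Let hits (x : R) : R := \sum_(j < n.*2.+1) \1_(ball y r) (x - shift j).

(** If a translate of x lies within r of y, then relative to it the left endpoint is at least d
    below and the right endpoint at least d above; by oddness and monotonicity the increment is at
    least 2 K(d), K being the primitive. The linear terms produced by the period cancel. *)
Let hits_kernel_le N d x : 0 < d ->
  hits x * (2 * kernel_primitive N d) <=
  kernel_primitive N (x - (y - r - d)) - kernel_primitive N (x - (y + r + d)).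
Proof.
move=> d0; case/andP: r01 => r0 r1.
have [/existsP[j hj]|/existsPn none] :=
    boolP [exists j : 'I_n.*2.+1, `|y - (x - shift j)| < r].
  have -> : hits x = 1.
    rewrite /hits (bigD1 j)//= indicE mem_set// big1 ?addr0// => i ij.
    rewrite indicE memNset//= /ball/= => hi.
    have ijR : 1 <= `|i%:R - j%:R| :> R.
      have [lij|lji|/val_inj eij] := ltngtP i j; last by rewrite eij eqxx in ij.
        rewrite distrC -natrB ?(ltnW lij)// ger0_norm// ler1n subn_gt0//.
      by rewrite -natrB ?(ltnW lji)// ger0_norm// ler1n subn_gt0.
    have : `|shift i - shift j| < 1.
      rewrite (_ : shift i - shift j =
        (y - (x - shift i)) - (y - (x - shift j))); last by ring.
      apply: le_lt_trans (ler_normB _ _) _; lra.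
    rewrite /shift -mulrBr normrM ger0_norm// (_ : _ - _ = j%:R - i%:R); last by ring.
    by rewrite distrC; lra.
  pose m : int := n%:Z - j%:Z; have mE : shift j = 2 * m%:~R.
    by rewrite /shift /m intrB -!pmulrn.
  rewrite mul1r.
  move: hj; rewrite ltr_norml mE => /andP[h1 h2].
  rewrite (_ : x - (y - r - d) = (x - 2 * m%:~R - y + r + d) + 2 * m%:~R); last by ring.
  rewrite (_ : x - (y + r + d) = (x - 2 * m%:~R - y - r - d) + 2 * m%:~R); last by ring.
  rewrite !kernel_primitive_period.
  have := @kernel_primitive_le R N d (x - 2 * m%:~R - y + r + d) ltac:(lra).
  have := @kernel_primitive_le R N (x - 2 * m%:~R - y - r - d) (- d) ltac:(lra).
  rewrite kernel_primitiveN; lra.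
have -> : hits x = 0.
  rewrite /hits big1// => i _; rewrite indicE memNset//= /ball/=.
  exact/negP/none.
by rewrite mul0r subr_ge0 kernel_primitive_le//; lra.
Qed.

Let measurable_hits : measurable_fun setT hits.
Proof.
apply: measurable_sum => j; apply: measurableT_comp; last exact: measurable_funB.
by apply: measurable_indic; exact: measurable_ball.
Qed.

Let hits_bound x : `|hits x| <= n.*2.+1%:R.
Proof.
rewrite ger0_norm ?sumr_ge0// /hits.
apply: (@le_trans _ _ (\sum_(j < n.*2.+1) 1)); last by rewrite sumr_const card_ord.
by apply: ler_sum => j _; rewrite indicE; case: (_ \in _).
Qed.

Let ihits : integrable (fun x => p x * hits x).
Proof. exact: (integrable_mul_bounded ip measurable_hits hits_bound). Qed.

Lemma Rintegral_hits_le : \int[mu]_x (p x * hits x) <= r.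
Proof.
case/andP: r01 => r0 r1.
set I := \int[mu]_x (p x * hits x).
(* The ball is enlarged by [d], and [e] is the share of the kernel's mass lost outside [-d, d]. *)
have key d e : 0 < d < 1 -> 0 < e -> (1 - e) * I <= r + d.
  move=> d01 e0; have [N hN] := kernel_primitive_mass d01 e0.
  have [iw ew] := integral_kernel_primitive N (y - r - d) (y + r + d).
  have d0 : 0 < d by case/andP: d01.
  have I0 : 0 <= I.
    by apply: Rintegral_ge0 => x _; rewrite mulr_ge0// sumr_ge0.
  have b0 := @central_bin_gt0 R N.
  have : 2 * kernel_primitive N d * I <= central_bin N * (2 * (r + d)).
    rewrite (_ : 2 * (r + d) = y + r + d - (y - r - d)); last by ring.
    rewrite -ew -RintegralZl//; apply: le_Rintegral => //.
      exact: (integrable_scale _ ihits).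
    by move=> x _; rewrite mulrCA ler_wpM2l// mulrC hits_kernel_le.
  move=> h; rewrite -(ler_pM2l b0); apply: (@le_trans _ _ (kernel_primitive N d * I)).
    by rewrite mulrA ler_wpM2r// mulrC.
  lra.
(* This crude bound turns (1 - d) I <= r + d into I <= r + 5 d, hence the choice d <= e / 5. *)
have I3 : I <= 4 by have := key 2^-1 2^-1 ltac:(lra) ltac:(lra); lra.
apply/ler_addgt0Pr => e e0.
pose d := Num.min 2^-1 (e / 5).
have [d0 [d1 d2]] : 0 < d /\ d <= 2^-1 /\ d <= e / 5.
  by rewrite lt_min !ge_min lexx lexx orbT; split=> //; apply/andP; split; lra.
have := key d d ltac:(lra) d0; nra.
Qed.

End ball_bound.

Let mp : measurable_fun setT p. Proof. exact: integrable_measurable. Qed.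

(** Translating each summand moves the shifts from p to the indicator of the ball, and the integral
    becomes that of p times the hit count. *)
Lemma integral_ball_periodization_le n y r : 0 < r < 2^-1 ->
  (\int[mu]_(x in ball y r) (\sum_(j < n.*2.+1) p (x + 2 * (n%:R - j%:R)))%:E
   <= r%:E)%E.
Proof.
move=> r01; set g := fun x => \sum_(j < n.*2.+1) p (x + 2 * (n%:R - j%:R)).
have mB := measurable_ball y r.
pose f (j : 'I_n.*2.+1) x := p x * \1_(ball y r) (x - 2 * (n%:R - j%:R)).
have mI j : measurable_fun setT (fun x : R => \1_(ball y r) (x - 2 * (n%:R - j%:R)) : R).
  by apply: measurableT_comp; [exact: measurable_indic|exact: measurable_funB].
have ind1 x : `|\1_(ball y r) x : R| <= 1.
  by rewrite indicE; case: (_ \in _); rewrite ?normr1 ?normr0.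
have fi j : integrable (f j).
  exact: (integrable_mul_bounded ip (mI j) (fun x => ind1 _)).
have gi : integrable (fun x => g x * \1_(ball y r) x).
  apply: (integrable_mul_bounded _ _ ind1) => //.
  by apply: integrable_big_sum => j; exact: integrable_shift.
have -> : (\int[mu]_(x in ball y r) (g x)%:E = \int[mu]_x (g x * \1_(ball y r) x)%:E)%E.
  rewrite integral_mkcond; apply: eq_integral => x _; rewrite patchE indicE.
  by case: (_ \in _); rewrite ?mulr1 ?mulr0.
rewrite -EFin_Rintegral// lee_fin; apply: le_trans (Rintegral_hits_le n y r01).
rewrite le_eqVlt; apply/orP; left; apply/eqP.
transitivity (\sum_j \int[mu]_x f j x).
  transitivity (\sum_j \int[mu]_x f j (x + 2 * (n%:R - j%:R))).
    rewrite -Rintegral_big_sum => [|j]; last exact: integrable_shift.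
    apply: eq_Rintegral => x _; rewrite /g mulr_suml; apply: eq_bigr => j _.
    by rewrite /f addrK.
  by apply: eq_bigr => j _; rewrite Rintegral_shift//; exact: integrable_measurable.
rewrite -Rintegral_big_sum//; apply: eq_Rintegral => x _.
by rewrite mulr_sumr.
Qed.

(** The mean over a ball of radius r is at most r / (2 r) = 1/2; the Lebesgue differentiation
    theorem passes this to almost every point. *)
Lemma periodization_ae_le n :
  {ae mu, forall x, \sum_(j < n.*2.+1) p (x + 2 * (n%:R - j%:R)) <= 2^-1}.
Proof.
set g := fun x => \sum_(j < n.*2.+1) p (x + 2 * (n%:R - j%:R)).
have gi : integrable g by apply: integrable_big_sum => j; exact: integrable_shift.
have gl : locally_integrable setT g by apply: open_integrable_locally => //; exact: openT.
pose rad k : {posnum R} := PosNum (harmonic_gt0 k).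
have shrink x : nicely_shrinking x (fun k => ball x (rad k)%:num).
  split=> [k|]; first exact: measurable_ball.
  exists (1, rad); split => //=; [exact: cvg_harmonic| |].
    by move=> k z.
  by move=> k; rewrite mul1e.
have aept : {ae mu, forall x, lebesgue_pt g x} by exact: lebesgue_differentiation.
apply: (@filterS _ _ (ae_filter_ringOfSetsType mu) _ _ _ aept) =>
  x /(nice_lebesgue_differentiation shrink gl) gx.
rewrite -lee_fin -/(g x) -(cvg_lim _ gx)//; apply: lime_le; first exact: cvgP gx.
(* The radius 1 / (k + 1) is strictly below 1/2 from k = 2 on. *)
near=> k; have k2 : (1 < k)%N by near: k; exact: nbhs_infty_gt.
have r01 : 0 < (rad k)%:num < (2^-1 : R).
  by rewrite gt0/= ltf_pV2 ?posrE// ltr_nat.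
rewrite lebesgue_measure_ball//= inver mulrn_eq0/= gt_eqF; last by case/andP: r01.
apply: (@le_trans _ _ (((rad k)%:num *+ 2)^-1%:E * (rad k)%:num%:E)%E).
  by rewrite lee_wpmul2l// integral_ball_periodization_le.
rewrite -EFinM lee_fin; case/andP: r01; move: (rad k)%:num => h h0 _.
by rewrite (_ : _ * h = 2^-1)// mulr2n; field; rewrite gt_eqF// addr_gt0.
Unshelve. all: by end_near. Qed.

End periodization.
(** * Necessity *)

Section uniform_density.
Context {R : realType}.
Local Notation mu := (@lebesgue_measure R).
Local Notation integrable f := (mu.-integrable setT (EFin \o f)).

Definition uniform_density (x : R) : R := 2^-1 * \1_`[(-1), 1]%classic x.

Lemma uniform_density_ge0 x : 0 <= uniform_density x.
Proof. by rewrite mulr_ge0// invr_ge0. Qed.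

Lemma uniform_density_le x : uniform_density x <= 2^-1.
Proof.
by rewrite /uniform_density indicE ler_piMr ?invr_ge0//; case: (_ \in _).
Qed.

Lemma integrable_uniform_density : integrable uniform_density.
Proof.
exact: (integrable_scale 2^-1 (integrable_indic_itv (-1) 1 true false)).
Qed.

Lemma Rintegral_uniform_density (f : R -> R) : continuous f ->
  \int[mu]_x (uniform_density x * f x) = 2^-1 * \int[mu]_(x in `[(-1), 1]) f x.
Proof.
move=> cf.
have E x : (f \_ `[(-1), 1]) x = \1_`[(-1), 1]%classic x * f x.
  by rewrite patchE indicE; case: (_ \in _); rewrite ?mul1r ?mul0r.
have fi : mu.-integrable `[(-1), 1] (EFin \o f).
  apply: continuous_compact_integrable; first exact: segment_compact.
  exact: continuous_subspaceT.
have fT : integrable (fun x => \1_`[(-1), 1]%classic x * f x).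
  apply: eq_integrable ((integrable_mkcond _ _).1 fi) => // x _ /=.
  by rewrite -E restrict_EFin.
have -> : \int[mu]_(x in `[(-1), 1]) f x = \int[mu]_x (\1_`[(-1), 1]%classic x * f x).
  by rewrite Rintegral_mkcond; apply: eq_Rintegral => x _; exact: E.
rewrite -RintegralZl//.
by apply: eq_Rintegral => x _; rewrite /uniform_density mulrA.
Qed.

Lemma Rintegral_uniform_density_derive (f F : R -> R) :
  (forall x, is_derive x (1 : R) F (f x)) -> continuous f ->
  \int[mu]_x (uniform_density x * f x) = (F 1 - F (-1)) / 2.
Proof.
move=> dF cf; have cF := is_derive_continuous dF.
have E : (\int[mu]_(x in `[(-1)%R, 1%R]) (f x)%:E = (F 1)%:E - (F (-1))%:E)%E.
  apply: continuous_FTC2; first lra.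
  - exact: continuous_subspaceT.
  - split => [u _||].
    + by case: (dF u).
    + exact/cvg_at_right_filter/cF.
    + exact/cvg_at_left_filter/cF.
  - by move=> u _; rewrite derive1E; exact: derive_val.
by rewrite Rintegral_uniform_density// /Rintegral E /= mulrC.
Qed.

Lemma Rintegral_uniform_density1 : \int[mu]_x uniform_density x = 1.
Proof.
have c1 : continuous (cst 1 : R -> R) by move=> x; exact: cvg_cst.
have := @Rintegral_uniform_density_derive (cst 1) id _ c1.
under eq_Rintegral do rewrite mulr1.
by move=> ->; field.
Qed.

Lemma Rintegral_uniform_density_cos (k : int) : k != 0 ->
  \int[mu]_x (uniform_density x * cos (pi * k%:~R * x)) = 0.
Proof.
move=> k0; rewrite (Rintegral_uniform_density_derive (is_derive_sin_primitive k)).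
  by rewrite sin_primitiveN sin_primitive1 (negbTE k0) opprK addr0 mul0r.
move=> x; apply: (@continuous_comp _ _ _ (fun x : R => pi * k%:~R * x) cos).
  by apply: cvgMr; exact: cvg_id.
exact: continuous_cos.
Qed.

Lemma Rintegral_uniform_density_sin (k : int) : k != 0 ->
  \int[mu]_x (uniform_density x * sin (pi * k%:~R * x)) = 0.
Proof.
move=> k0; set t := pi * k%:~R.
have t0 : t != 0 by rewrite mulf_neq0 ?intr_eq0// gt_eqF ?pi_gt0.
have d x : is_derive x (1 : R) (fun x => - cos (t * x) / t) (sin (t * x)).
  by apply: is_derive_eq; rewrite /GRing.scale /=; field.
rewrite (Rintegral_uniform_density_derive d).
  by rewrite mulrN cosN subrr mul0r.
move=> x; apply: (@continuous_comp _ _ _ (fun x : R => t * x) sin).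
  by apply: cvgMr; exact: cvg_id.
exact: continuous_sin.
Qed.

(** At odd integers two closed tiles can meet, so the bound is only almost everywhere. It is read
    off from the vanishing Fourier coefficients. *)
Lemma uniform_periodization n : {ae mu, forall x,
  \sum_(j < n.*2.+1) uniform_density (x + 2 * (n%:R - j%:R)) <= 2^-1}.
Proof.
apply: periodization_ae_le.
- exact: integrable_uniform_density.
- exact: uniform_density_ge0.
- exact: Rintegral_uniform_density1.
- exact: Rintegral_uniform_density_cos.
- exact: Rintegral_uniform_density_sin.
Qed.

Lemma cvg_walk_uniform_density :
  (fun n => \int[mu]_x (walk_density uniform_density n x - normal_pdf 0 1 x) ^+ 2) @ \oo
  --> (0 : R).
Proof.
apply: cvg_walk_density.
- exact: integrable_uniform_density.
- exact: uniform_density_ge0.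
- exact: uniform_density_le.
- exact: Rintegral_uniform_density1.
- exact: uniform_periodization.
Qed.

End uniform_density.

(** * Vanishing Fourier coefficients from L2 convergence *)

Section necessity.
Context {R : realType}.
Local Notation mu := (@lebesgue_measure R).
Local Notation integrable f := (mu.-integrable setT (EFin \o f)).
Variables (p c : R -> R) (s : R).
Hypotheses (ip : integrable p) (mc : measurable_fun setT c) (c1 : forall x, `|c x| <= 1).
Hypotheses (s1 : `|s| = 1) (cD : forall x, c (x + 1) = s * c x)
  (cB : forall x, c (x - 1) = s * c x).
Hypothesis unif0 : \int[mu]_x (uniform_density x * c x) = 0.
(** A square with infinite integral would have real-valued integral [fine +oo] = 0, so the limit
    [cvgp] is informative only together with eventual integrability. *)
Hypothesis ip2 : \forall n \near \oo,
  integrable (fun x => (walk_density p n x - normal_pdf 0 1 x) ^+ 2).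
Hypothesis cvgp : (fun n => \int[mu]_x (walk_density p n x - normal_pdf 0 1 x) ^+ 2) @ \oo
  --> (0 : R).

Let pdf_le1 x : `|normal_pdf 0 1 x : R| <= 1.
Proof.
by rewrite normal_pdf01E ger0_norm ?gauss_density_ge0 ?gauss_density_le1.
Qed.

Let test n x := c (Num.sqrt n%:R * x) * normal_pdf 0 1 x.

Let measurable_test n : measurable_fun setT (test n).
Proof.
apply: measurable_funM; last exact: measurable_normal_pdf.
by apply: (measurableT_comp mc); exact: measurable_funM.
Qed.

Let test_le n x : `|test n x| <= normal_pdf 0 1 x.
Proof.
by rewrite normrM (ger0_norm (normal_pdf_ge0 _ _ _)) ler_piMl// normal_pdf_ge0.
Qed.

Let test_le1 n x : `|test n x| <= 1.
Proof.
by apply: le_trans (test_le n x) _; apply: le_trans (ler_norm _) (pdf_le1 x).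
Qed.

Let Rintegral_test (q : R -> R) n : (0 < n)%N -> integrable q ->
  \int[mu]_x (walk_density q n x * test n x) =
  s ^+ n * \int[mu]_x (q x * (c x * walk_pdf n x)).
Proof.
move=> n0 iq; rewrite (Rintegral_walk_density n0 iq mc c1) -RintegralZl//.
  by apply: eq_Rintegral => x _; rewrite (iter_walkM n _ cD cB) /walk_pdf; ring.
have := integrable_mul_bounded (integrable_mul_bounded iq mc c1)
  (@measurable_walk_pdf _ n) (walk_pdf_norm_le1 n).
by apply: eq_integrable => // x _ /=; rewrite mulrA.
Qed.

(* AM-GM: [|r h| <= e phi^2 + r^2 / (4 e)] for [|h| <= phi]. *)
Let test_bound (r : R -> R) n e : 0 < e -> integrable r ->
  integrable (fun x => r x ^+ 2) ->
  `|\int[mu]_x (r x * test n x)| <=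
  e * (2 * Num.sqrt pi)^-1 + (4 * e)^-1 * \int[mu]_x r x ^+ 2.
Proof.
move=> e0 ir ir2; have [iN eN] := @Rintegral_sqr_normal_pdf R.
have it : integrable (fun x => r x * test n x).
  exact: (integrable_mul_bounded ir (@measurable_test n) (test_le1 n)).
apply: (le_trans (le_normr_Rintegral _ it)) => //.
rewrite -eN -!RintegralZl// -RintegralD//; last 2 first.
  exact: integrable_scale.
  exact: integrable_scale.
apply: le_Rintegral => //.
- by have := integrable_norm it; apply: eq_integrable.
- by apply: integrable_add; exact: integrable_scale.
move=> x _; rewrite normrM; apply: (@le_trans _ _ (`|r x| * normal_pdf 0 1 x)).
  by rewrite ler_wpM2l.
rewrite -[X in _ + _ * X]real_normK ?num_real// -subr_ge0.
set u := `|r x|; set v := normal_pdf 0 1 x.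
rewrite (_ : _ - _ = (4 * e)^-1 * (u - 2 * e * v) ^+ 2).
  by rewrite mulr_ge0 ?sqr_ge0// invr_ge0 mulr_ge0// ltW.
by field; rewrite gt_eqF.
Qed.

(** The walk densities of p and of the uniform law are both L2-close to phi, so they give nearly the
    same integral against the test function. The factor s^n has modulus 1 and the uniform side tends
    to 0, so Phi_n(0) * |I| is small, while Phi_n(0) stays near c0 or above. *)
Lemma Rintegral_test_eq0 : \int[mu]_x (p x * c x) = 0.
Proof.
set I := \int[mu]_x (p x * c x); set c0 : R := (2 * Num.sqrt pi)^-1.
have c00 : 0 < c0 by rewrite invr_gt0 mulr_gt0// sqrtr_gt0 pi_gt0.
pose err q n := \int[mu]_x (q x * (c x * walk_pdf n x)) -
            walk_pdf n 0 * \int[mu]_x (q x * c x).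
have iu := @integrable_uniform_density R.
have e1 : err p @ \oo --> (0 : R) by exact: cvg_Rintegral_walk_pdf.
have e2 : err uniform_density @ \oo --> (0 : R) by exact: cvg_Rintegral_walk_pdf.
pose L2 q n := \int[mu]_x (walk_density q n x - normal_pdf 0 1 x) ^+ 2.
have key e : 0 < e -> c0 * `|I| <= e * (2 * c0).
  move=> e0.
  (* For fixed [e], compare the limits of a lower bound and an upper bound for Phi_n(0) * |I|; [e]
     goes to 0 only at the end. *)
  pose lo n := (c0 - 5 * ((Num.sqrt n%:R)^-1 * (Num.sqrt n%:R)^-1)) * `|I|.
  pose hi n := e * (2 * c0) + (4 * e)^-1 * (L2 p n + L2 uniform_density n) +
     (`|err p n| + `|err uniform_density n|).
  have lo0 : lo @ \oo --> (c0 - 5 * (0 * 0)) * `|I|.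
    apply: cvgMl; apply: cvgB; first exact: cvg_cst.
    by apply: cvgMr; apply: cvgM; exact: cvg_sqrt_natV.
  have hi0 : hi @ \oo --> e * (2 * c0) + (4 * e)^-1 * (0 + 0) + (0 + 0).
    apply: cvgD.
      apply: cvgD; first exact: cvg_cst.
      by apply: cvgMr; apply: cvgD; [exact: cvgp|exact: cvg_walk_uniform_density].
    by apply: cvgD; apply: (iffRL (norm_cvg0P _)).
  suff : (c0 - 5 * (0 * 0)) * `|I| <= e * (2 * c0) + (4 * e)^-1 * (0 + 0) + (0 + 0).
    by rewrite !(mulr0, addr0, subr0).
  apply: (ler_cvg_to lo0 hi0); near=> n.
  have n0 : (0 < n)%N by near: n; exact: nbhs_infty_gt.
  have ipn : integrable (fun x => (walk_density p n x - normal_pdf 0 1 x) ^+ 2).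
    by near: n.
  have iun : integrable
      (fun x => (walk_density uniform_density n x - normal_pdf 0 1 x) ^+ 2).
    have := @Rintegral_sqr_walk_density_sub R uniform_density iu uniform_density_ge0
      uniform_density_le Rintegral_uniform_density1 uniform_periodization n n0.
    by case.
  have iN : integrable (normal_pdf 0 1) := integrable_normal_pdf 0 1.
  have dist q : integrable q ->
      integrable (fun x => (walk_density q n x - normal_pdf 0 1 x) ^+ 2) ->
      `|\int[mu]_x (walk_density q n x * test n x) -
        \int[mu]_x (normal_pdf 0 1 x * test n x)| <= e * c0 + (4 * e)^-1 * L2 q n.
    move=> iq iq2; have iqn := integrable_walk_density n0 iq.
    have := test_bound n e0 (integrable_sub iqn iN) iq2.
    rewrite -RintegralB//.
    - by under eq_Rintegral do rewrite mulrBl.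
    - exact: (integrable_mul_bounded iqn (@measurable_test n) (test_le1 n)).
    - exact: (integrable_mul_bounded iN (@measurable_test n) (test_le1 n)).
  have := dist _ ip ipn; have := dist _ iu iun.
  rewrite !Rintegral_test//; set M := \int[mu]_x (normal_pdf 0 1 x * test n x).
  have errp : \int[mu]_x (p x * (c x * walk_pdf n x)) = err p n + walk_pdf n 0 * I.
    by rewrite /err -/I subrK.
  have erru : \int[mu]_x (uniform_density x * (c x * walk_pdf n x)) =
      err uniform_density n.
    by rewrite /err unif0 mulr0 subr0.
  rewrite errp erru => hu hp.
  have : `|err p n + walk_pdf n 0 * I - err uniform_density n| <=
      e * (2 * c0) + (4 * e)^-1 * (L2 p n + L2 uniform_density n).
    have sn : `|s ^+ n| = 1 by rewrite normrX s1 expr1n.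
    rewrite (_ : `|_ - _| =
      `|s ^+ n * (err p n + walk_pdf n 0 * I - err uniform_density n)|);
      last by rewrite normrM sn mul1r.
    rewrite mulrBr.
    set A := s ^+ n * _ in hp *; set B := s ^+ n * _ in hu *.
    (* The integral [M] of phi against the test function is never computed: it is eliminated by the
       triangle inequality. *)
    apply: (le_trans (ler_distD M A B)); rewrite (distrC M).
    by apply: (le_trans (lerD hp hu)); rewrite le_eqVlt; apply/orP; left; apply/eqP; ring.
  move=> h; rewrite /lo /hi -lerBlDr.
  have w0 := walk_pdf_ge0 n (0 : R).
  have h2 : walk_pdf n 0 * `|I| <= `|err p n + walk_pdf n 0 * I - err uniform_density n| +
      (`|err p n| + `|err uniform_density n|).
    rewrite -{1}(ger0_norm w0) -normrM.
    rewrite [X in `|X| <= _](_ : walk_pdf n 0 * I =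
       (err p n + walk_pdf n 0 * I - err uniform_density n) -
       (err p n - err uniform_density n)); last by ring.
    apply: (le_trans (ler_normB _ _)); apply: lerD => //; exact: ler_normB.
  rewrite lerBlDr; apply: le_trans (_ : walk_pdf n 0 * `|I| <= _); last first.
    by apply: (le_trans h2); rewrite lerD2r.
  rewrite ler_wpM2r// -invfM -expr2 sqr_sqrtr//; exact: iter_walk_scaled_pdf_ge.
apply/eqP; rewrite -normr_le0; apply/ler_addgt0Pr => e e0; rewrite add0r.
rewrite -(ler_pM2l c00); apply: le_trans (key (e / 2) _) _; first by rewrite divr_gt0.
by rewrite le_eqVlt; apply/orP; left; apply/eqP; field.
Unshelve. all: by end_near. Qed.

End necessity.
(** * Densities of random variables *)

Section affine_density.
Context {R : realType}.
Local Notation mu := (@lebesgue_measure R).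

Lemma integral_affine_preimage a b (A : set R) (f : R -> R) : 0 < a ->
  measurable A -> measurable_fun setT f ->
  (\int[mu]_(z in [set z | A ((z - b) / a)%R]) (f z)%:E =
   \int[mu]_(x in A) (a * f (a * x + b))%:E)%E.
Proof.
move=> a0 mA mf; set D := [set z | _].
have mD : measurable D.
  rewrite -[D]setTI.
  suff : measurable_fun setT (fun z : R => (z - b) / a) by apply.
  by apply: measurable_funM => //; exact: measurable_funB.
have mfD : measurable_fun setT ((EFin \o f) \_ D).
  by apply/(measurable_restrictT _ mD); apply: measurable_funTS; exact/measurable_EFinP.
rewrite integral_mkcond (integral_affine b a0 mfD) [RHS]integral_mkcond.
apply: eq_integral => x _; rewrite !patchE.
rewrite (_ : (a * x + b \in D) = (x \in A)).
  by case: ifP => _ /=; rewrite ?EFinM ?mule0.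
by apply/idP/idP; rewrite !inE /D /= addrK mulrC mulKf ?gt_eqF.
Qed.

End affine_density.

Section densities.
Context d (T : measurableType d) (R : realType) (P : probability T R).
Local Notation mu := (@lebesgue_measure R).
Local Notation integrable f := (mu.-integrable setT (EFin \o f)).
Implicit Types (p f g : R -> R).

Lemma has_density_integrable (X : T -> R) p : has_density P X p -> integrable p.
Proof.
move=> [mp p0 pX]; apply/integrableP; split; first exact/measurable_EFinP.
under eq_integral do rewrite /= ger0_norm//.
by rewrite -pX// preimage_setT probability_setT ltry.
Qed.

Lemma has_density_Rintegral1 (X : T -> R) p : has_density P X p -> \int[mu]_x p x = 1.
Proof.
by move=> [mp p0 pX]; rewrite /Rintegral -pX// preimage_setT probability_setT.
Qed.

Lemma has_density_ae_eq (X : T -> R) p q : has_density P X p ->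
  has_density P X q -> ae_eq mu setT (EFin \o p) (EFin \o q).
Proof.
move=> Xp [mq q0 qX]; have ip := has_density_integrable Xp; case: Xp => mp p0 pX.
apply: (integral_ae_eq _ ip) => //; first exact/measurable_EFinP.
by move=> A _ mA; rewrite -pX// -qX.
Qed.

(** The law of X is absolutely continuous, so the integral can be computed with its Radon-Nikodym
    derivative, which equals p almost everywhere because both have the same integral on every
    measurable set. *)
Lemma ge0_integral_has_density (X : {RV P >-> R}) p (f : R -> \bar R) :
  has_density P X p -> measurable_fun setT f -> (forall x, 0 <= f x)%E ->
  (\int[P]_w f (X w) = \int[mu]_x (f x * (p x)%:E))%E.
Proof.
move=> Xp mf f0; have ip := has_density_integrable Xp; case: Xp => mp p0 pX.
(* X is viewed as a map into [measurableTypeR R], so that its law and [mu] are measures on the same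
   type. *)
have mX : measurable_fun setT (X : T -> measurableTypeR R).
  exact: (@measurable_funP _ _ _ _ setT X).
pose X' : {RV P >-> measurableTypeR R} :=
  HB.pack (X : T -> measurableTypeR R) (isMeasurableFun.Build _ _ _ _ _ mX).
pose nu := distribution P X'.
have numu : nu `<< mu.
  apply/null_content_dominatesP => A mA A0.
  rewrite /nu /distribution /pushforward pX//; apply: null_set_integral => //.
  exact/measurable_funTS/measurable_EFinP.
rewrite -[LHS](ge0_integral_distribution X' mf f0).
rewrite -(Radon_Nikodym_SigmaFinite.change_of_variables numu)//.
have mRN := measurable_int _ (Radon_Nikodym_SigmaFinite.f_integrable numu).
apply: ge0_ae_eq_integral => //.
- exact: emeasurable_funM.
- by apply: emeasurable_funM => //; exact/measurable_EFinP.
- by move=> x _; rewrite mule_ge0// Radon_Nikodym_SigmaFinite.f_ge0.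
- by move=> x _; rewrite mule_ge0// lee_fin.
apply: ae_eqe_mul2l; apply: integral_ae_eq => //.
- exact: Radon_Nikodym_SigmaFinite.f_integrable.
- exact/measurable_EFinP.
- by move=> A _ mA; rewrite -Radon_Nikodym_SigmaFinite.f_integral// -pX.
Qed.

Lemma expectation_has_density (X : {RV P >-> R}) p g k : has_density P X p ->
  measurable_fun setT g -> (forall x, `|g x| <= k) ->
  fine ('E_P[fun w => g (X w)])%E = \int[mu]_x (p x * g x).
Proof.
move=> Xp mg gk; rewrite unlock /Rintegral; congr fine.
have [mp p0 pX] := Xp.
have mg' : measurable_fun setT (EFin \o g) by exact/measurable_EFinP.
rewrite [LHS]integralE [RHS]integralE; congr (_ - _)%E.
- transitivity (\int[P]_w ((EFin \o g)^\+ (X w)))%E.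
    by apply: eq_integral => w _; rewrite !funeposE.
  rewrite (ge0_integral_has_density Xp (measurable_funepos mg'))//.
  apply: eq_integral => x _; rewrite !funeposE /= -!EFin_max -EFinM; congr EFin.
  by rewrite maxr_pMl// mul0r mulrC.
- transitivity (\int[P]_w ((EFin \o g)^\- (X w)))%E.
    by apply: eq_integral => w _; rewrite !funenegE.
  rewrite (ge0_integral_has_density Xp (measurable_funeneg mg'))//.
  apply: eq_integral => x _; rewrite !funenegE /= -!EFin_max -EFinM; congr EFin.
  by rewrite maxr_pMl// mul0r mulNr mulrC.
Qed.

Lemma char_fun_has_density (X : {RV P >-> R}) p t : has_density P X p ->
  char_fun P X t = (\int[mu]_x (p x * cos (t * x)) +i*
                    \int[mu]_x (p x * sin (t * x)))%C.
Proof.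
move=> Xp; rewrite /char_fun /Cexpectation /expi /=.
rewrite (expectation_has_density Xp (measurable_cosM t) (fun x => cos_max _)).
by rewrite (expectation_has_density Xp (measurable_sinM t) (fun x => sin_max _)).
Qed.

End densities.

(** * The law of the walk started from X *)

Section walk_law.
Context d (T : measurableType d) (R : realType) (P : probability T R).
Local Notation mu := (@lebesgue_measure R).
Local Notation integrable f := (mu.-integrable setT (EFin \o f)).
Variables (X : {RV P >-> R}) (p : R -> R) (Xs : nat -> {RV P >-> R}).
Hypotheses (hX : has_density P X p)
  (hXs : forall n, (1 <= n)%N -> symmetric_bernoulli P (Xs n))
  (hind : mutually_independent P
     (fun i : nat => if i == 0%N then (X : T -> R) else (Xs i : T -> R))).

Let ip : integrable p. Proof. exact: has_density_integrable hX. Qed.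
Let mp : measurable_fun setT p. Proof. by case: hX. Qed.
Let p0 x : 0 <= p x. Proof. by case: hX. Qed.

Let partial_sum n w := X w + \sum_(1 <= i < n.+1) Xs i w.

Let measurable_partial_sum n : measurable_fun setT (partial_sum n).
Proof.
apply: measurable_funD => //.
by apply: measurable_sum => i; exact: measurable_funPT.
Qed.

Let preim_meas (Y : T -> R) (A : set R) : measurable_fun setT Y -> measurable A ->
  measurable (Y @^-1` A).
Proof. by move=> mY mA; rewrite -[X in measurable X]setTI; exact: mY. Qed.

Let cylinder (J : {fset nat}) (B : nat -> set R) :=
  \bigcap_(i in [set` J]) (Xs i @^-1` B i).

Let measurable_cylinder J B : (forall i, i \in J -> measurable (B i)) ->
  measurable (cylinder J B).
Proof.
move=> mB; apply: fin_bigcap_measurable => // i iJ.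
by apply: preim_meas; [exact: measurable_funPT|exact: mB].
Qed.

(** The values 1 and -1 carry total mass 1/2 + 1/2 = 1, so the rest of [E] is null. *)
Let bernoulli_split n (E : set T) : (0 < n)%N -> measurable E ->
  P E = (P (E `&` Xs n @^-1` [set 1%R]) + P (E `&` Xs n @^-1` [set (-1)%R]))%E.
Proof.
move=> n0 mE; have [h1 h2] := hXs n0.
have m1 : measurable (Xs n @^-1` [set 1%R]) by apply: preim_meas.
have m2 : measurable (Xs n @^-1` [set (-1)%R]) by apply: preim_meas.
have dis : Xs n @^-1` [set 1%R] `&` Xs n @^-1` [set (-1)%R] = set0.
  apply/seteqP; split => // w [/= -> /eqP]; by rewrite eq_sym lt_eqF//; lra.
set D := Xs n @^-1` [set 1%R] `|` Xs n @^-1` [set (-1)%R].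
have mD : measurable D by exact: measurableU.
have PD : P D = 1%E.
  by rewrite measureU// [X in (X + _)%E]h1 [X in (_ + X)%E]h2 -EFinD; congr EFin; field.
have PDC : P (E `\` D) = 0%E.
  apply/eqP; rewrite eq_le measure_ge0 andbT.
  apply: (@le_trans _ _ (P (~` D))).
    by rewrite le_measure ?inE//; [exact: measurableD|exact: measurableC].
  by rewrite probability_setC// PD subee.
rewrite (measureDI P mE mD) [X in (X + _)%E]PDC add0e setIUr measureU//.
all: try exact: measurableI.
by rewrite setIACA setIid dis setI0.
Qed.

(** Carrying a cylinder over the later steps makes the induction close: independence of the partial
    sum from the next step is part of the induction hypothesis. *)
Lemma partial_sum_cylinder n (A : set R) J B : measurable A ->
  (forall i, i \in J -> (n < i)%N) -> (forall i, i \in J -> measurable (B i)) ->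
  P (partial_sum n @^-1` A `&` cylinder J B) =
  ((\int[mu]_(x in A) (iter n walk p x)%:E) * \prod_(i <- J) P (Xs i @^-1` B i))%E.
Proof.
elim: n A J B => [|n IH] A J B mA Jn mB.
  have [_ _ pX] := hX.
  (* Index 0 of the independent family is X itself; it is adjoined to [J] to apply [hind]. *)
  have N0 : 0%N \notin J by apply/negP => /Jn.
  pose B' i := if i == 0%N then A else B i.
  have mB' i : i \in (0%N |` J)%fset -> measurable (B' i).
    rewrite /B' in_fset1U; have [//|_ /=] := eqVneq i 0%N; exact: mB.
  have ps0 : partial_sum 0 = X.
    by apply/funext => w; rewrite /partial_sum big_geq// addr0.
  have eJ i : i \in J -> (if i == 0%N then X : T -> R else Xs i) @^-1` B' i =
      Xs i @^-1` B i.
    by move=> /Jn; case: i.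
  have := hind mB'; rewrite set_fsetU1 bigcap_setU1 big_fsetU1//= {1 3}/B' eqxx.
  rewrite pX// (@eq_bigcapr _ _ _ _ (fun i => Xs i @^-1` B i)) => [h|i]; last exact: eJ.
  rewrite ps0 {}[LHS]h; congr (_ * _)%E.
  by apply: eq_big_seq => i /eJ ->.
have mA1 b : measurable [set z : R | A (z + b)].
  have mb : measurable_fun setT (fun z : R => z + b) by exact: measurable_funD.
  by rewrite -[X in measurable X]setTI; exact: mb.
(* On the event that step n + 1 equals b, the set [A] is shifted by b and the event joins the
   cylinder as a condition at index n + 1. *)
have half b : b = 1 \/ b = -1 ->
    P (partial_sum n.+1 @^-1` A `&` cylinder J B `&` Xs n.+1 @^-1` [set b]) =
    ((\int[mu]_(x in A) (iter n walk p (x - b))%:E) *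
     ((2^-1)%:E * \prod_(i <- J) P (Xs i @^-1` B i)))%E.
  move=> bE; pose B' i := if i == n.+1 then [set b] else B i.
  have nJ : n.+1 \notin J by apply/negP => /Jn; rewrite ltnn.
  have mB' i : i \in (n.+1 |` J)%fset -> measurable (B' i).
    rewrite /B' in_fset1U; have [//|_ /=] := eqVneq i n.+1; exact: mB.
  have Jn' i : i \in (n.+1 |` J)%fset -> (n < i)%N.
    by rewrite in_fset1U => /predU1P[->//|/Jn/ltnW].
  have := IH _ _ _ (mA1 b) Jn' mB'.
  rewrite big_fsetU1//= {2}/B' eqxx.
  have -> : P (Xs n.+1 @^-1` [set b]) = (2^-1)%:E.
    by have [h1 h2] := hXs (ltn0Sn n); case: bE => ->.
  have eJ i : i \in J -> Xs i @^-1` B' i = Xs i @^-1` B i.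
    by move=> iJ; rewrite /B'; case: eqVneq => // iE; rewrite iE (negbTE nJ) in iJ.
  rewrite (eq_big_seq (fun i => P (Xs i @^-1` B i))); last by move=> i /eJ ->.
  rewrite {1}/cylinder set_fsetU1 bigcap_setU1 {1}/B' eqxx.
  rewrite (@eq_bigcapr _ _ _ _ (fun i => Xs i @^-1` B i)); last exact: eJ.
  rewrite -/(cylinder J B).
  have -> : (\int[mu]_(x in [set z | A (z + b)%R]) (iter n walk p x)%:E =
      \int[mu]_(x in A) (iter n walk p (x - b))%:E)%E.
    have := integral_affine_preimage (- b) ltr01 mA (measurable_iter_walk n mp).
    rewrite (_ : [set z | _] = [set z | A (z + b)]); last first.
      by apply/seteqP; split=> z /=; rewrite opprK divr1.
    by move=> ->; apply: eq_integral => x _; rewrite !mul1r.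
  move=> <-; congr (P _); apply/seteqP; split=> w /=.
    move=> [[h1 h2] h3]; split; last by split.
    by move: h1; rewrite /partial_sum big_nat_recr//= h3 addrA.
  move=> [h1 [h2 h3]]; split; last by [].
  by split=> //; rewrite /partial_sum big_nat_recr//= h2 addrA.
rewrite (@bernoulli_split n.+1)//; last first.
  by apply: measurableI; [exact: preim_meas|exact: measurable_cylinder].
rewrite !half; [|by right|by left].
set c := (\prod_(i <- J) _)%E.
have W0 y : 0 <= iter n walk p y by exact: iter_walk_ge0.
have mW y : measurable_fun A (fun x => (iter n walk p (x + y))%:E).
  apply: measurable_funTS; apply/measurable_EFinP.
  by apply: (measurableT_comp (measurable_iter_walk n mp)); exact: measurable_funD.
have -> : (\int[mu]_(x in A) (iter n.+1 walk p x)%:E = (2^-1)%:E *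
    (\int[mu]_(x in A) (iter n walk p (x - 1))%:E +
     \int[mu]_(x in A) (iter n walk p (x - -1))%:E))%E.
  rewrite -ge0_integralD//; try by move=> x _; rewrite lee_fin.
  rewrite -ge0_integralZl//.
  - by apply: eq_integral => x _; rewrite opprK /= /walk mulrC addrC.
  - by apply: emeasurable_funD; exact: mW.
  - by move=> x _; rewrite adde_ge0// lee_fin.
  - exact: mW.
  - exact: mW.
rewrite -ge0_muleDl; [|by apply: integral_ge0 => x _; rewrite lee_fin..].
by rewrite muleA (muleC _ (2^-1)%:E).
Qed.

Lemma has_density_norm_sum n : (0 < n)%N ->
  has_density P (norm_sum X (fun i => Xs i : T -> R) n) (walk_density p n).
Proof.
move=> n0; have r0 : 0 < Num.sqrt n%:R :> R by rewrite sqrtr_gt0 ltr0n.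
split.
- by apply: integrable_measurable; exact: integrable_walk_density.
- by move=> x; rewrite mulr_ge0 ?sqrtr_ge0// iter_walk_ge0.
move=> A mA.
have mA' : measurable [set z : R | A (z / Num.sqrt n%:R)].
  have mb : measurable_fun setT (fun z : R => z / Num.sqrt n%:R).
    exact: measurable_funM.
  by rewrite -[X in measurable X]setTI; exact: mb.
have := @partial_sum_cylinder n _ fset0 (fun=> setT) mA'.
rewrite /cylinder set_fset0 bigcap_set0 setIT big_seq_fset0 mule1 => law.
rewrite [LHS]law//.
have := integral_affine_preimage 0 r0 mA (measurable_iter_walk n mp).
rewrite (_ : [set z | _] = [set z | A (z / Num.sqrt n%:R)]); last first.
  by apply/seteqP; split=> z /=; rewrite subr0.
by move=> ->; apply: eq_integral => x _; rewrite addr0.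
Qed.

End walk_law.

(** * The L2 norm as an integral of squares *)

Section L2norm.
Context {R : realType}.
Local Notation mu := (@lebesgue_measure R).
Local Notation integrable f := (mu.-integrable setT (EFin \o f)).
Implicit Types u v : R -> R.

Lemma L2normE u : L2norm u = ((\int[mu]_x (u x ^+ 2)%:E) `^ 2^-1)%E.
Proof.
rewrite /L2norm unlock; congr (_ `^ _)%E; apply: eq_integral => x _.
by rewrite /comp abse_EFin poweR_EFin powR_mulrn// real_normK// num_real.
Qed.

Lemma L2norm_integrable u : integrable (fun x => u x ^+ 2) ->
  L2norm u = (Num.sqrt (\int[mu]_x u x ^+ 2))%:E.
Proof.
move=> iu; rewrite L2normE -EFin_Rintegral// poweR_EFin powR12_sqrt//.
by apply: Rintegral_ge0 => x _; exact: sqr_ge0.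
Qed.

Lemma L2norm_lty_integrable u : measurable_fun setT u -> (L2norm u < +oo)%E ->
  integrable (fun x => u x ^+ 2).
Proof.
move=> mu_; rewrite L2normE => h; apply/integrableP; split.
  by apply/measurable_EFinP; exact: measurable_funX.
under eq_integral do rewrite /= ger0_norm ?sqr_ge0//.
exact: lty_poweRy h.
Qed.

Lemma L2norm_ae_eq u v : measurable_fun setT u -> measurable_fun setT v ->
  ae_eq mu setT (EFin \o u) (EFin \o v) -> L2norm u = L2norm v.
Proof.
move=> mu_ mv uv; rewrite !L2normE; congr (_ `^ _)%E.
apply: ge0_ae_eq_integral => //.
- by apply/measurable_EFinP; exact: measurable_funX.
- by apply/measurable_EFinP; exact: measurable_funX.
- by move=> x _; rewrite lee_fin sqr_ge0.
- by move=> x _; rewrite lee_fin sqr_ge0.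
by apply: (@filterS _ _ (ae_filter_ringOfSetsType mu) _ _ _ uv) => x /(_ Logic.I) [->].
Qed.

End L2norm.

(** Upgrades an almost everywhere bound to one valid at every point, as [cvg_walk_density] demands,
    by changing the density on a null set. *)
Lemma has_density_min d (T : measurableType d) (R : realType) (P : probability T R)
    (X : T -> R) (p : R -> R) (k : R) : has_density P X p -> 0 <= k ->
  {ae @lebesgue_measure R, forall x, p x <= k} ->
  has_density P X (fun x => Num.min (p x) k).
Proof.
move=> [mp p0 pX] k0 pk; split.
- exact: measurable_minr.
- by move=> x; rewrite le_min p0.
move=> A mA; rewrite pX//; apply: ge0_ae_eq_integral => //.
- by apply: measurable_funTS; exact/measurable_EFinP.
- by apply: measurable_funTS; apply/measurable_EFinP; exact: measurable_minr.
- by move=> x _; rewrite lee_fin.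
- by move=> x _; rewrite lee_fin le_min p0.
apply: (@filterS _ _ (ae_filter_ringOfSetsType lebesgue_measure) _ _ _ pk) => x h _.
by rewrite /= min_l.
Qed.

Lemma normal_pdf_sub_ae_eq (R : realType) (f g : R -> R) :
  ae_eq lebesgue_measure setT (EFin \o f) (EFin \o g) ->
  ae_eq lebesgue_measure setT
    (EFin \o (fun x => f x - normal_pdf 0 1 x))
    (EFin \o (fun x => g x - normal_pdf 0 1 x)).
Proof.
move=> fg; apply: (@filterS _ _ (ae_filter_ringOfSetsType lebesgue_measure) _ _ _ fg).
by move=> x /(_ Logic.I) [fgx] _ /=; rewrite fgx.
Qed.

(** As sin (pi k) = 0, the addition formulas keep only the factor cos (pi k), the sign s of the
    necessity argument. *)
Lemma cos_sin_pi_int_shift (R : realType) (k : int) (x : R) :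
  [/\ cos (pi * k%:~R * (x + 1)) = cos (pi * k%:~R) * cos (pi * k%:~R * x),
      cos (pi * k%:~R * (x - 1)) = cos (pi * k%:~R) * cos (pi * k%:~R * x),
      sin (pi * k%:~R * (x + 1)) = cos (pi * k%:~R) * sin (pi * k%:~R * x) &
      sin (pi * k%:~R * (x - 1)) = cos (pi * k%:~R) * sin (pi * k%:~R * x)].
Proof.
have s0 := @sin_pi_int R k; rewrite !mulrDr !mulrN mulr1 !cosB !sinB !cosD !sinD s0.
by split; ring.
Qed.

Theorem theorem1p1 (R : realType) (d : measure_display) (T : measurableType d)
    (P : probability T R) (X : {RV P >-> R}) (p : R -> R)
    (Xs : nat -> {RV P >-> R}) (pn : nat -> R -> R)
    (hX : has_density P X p)
    (hXs : forall n, (1 <= n)%N -> symmetric_bernoulli P (Xs n))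
    (hind : mutually_independent P
       (fun i : nat => if i == 0%N then (X : T -> R) else (Xs i : T -> R)))
    (hpn : forall n, (1 <= n)%N ->
       has_density P (norm_sum X (fun i => Xs i : T -> R) n) (pn n)) :
  (((fun n => L2norm (fun x => pn n x - normal_pdf 0 1 x)) @ \oo
      --> 0%E) ->
    forall k : int, k != 0 -> char_fun P X (pi * k%:~R) = 0)
  /\
  (('E_P[fun w => `|X w|%R] < +oo)%E ->
   (L2norm (fun t => Normc.normc (Cderive1 (char_fun P X) t)) < +oo)%E ->
   (forall k : int, k != 0 -> char_fun P X (pi * k%:~R) = 0) ->
   (fun n => L2norm (fun x => pn n x - normal_pdf 0 1 x)) @ \oo
     --> 0%E).
Proof.
(* Two densities of Z_n agree almost everywhere. Here [q] is any density of X: [p] itself for the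
   first claim, its truncation at 1/2 for the second. *)
have L2E q n : has_density P X q -> (0 < n)%N ->
    measurable_fun setT (fun x => walk_density q n x - normal_pdf 0 1 x) /\
    L2norm (fun x => pn n x - normal_pdf 0 1 x) =
    L2norm (fun x => walk_density q n x - normal_pdf 0 1 x).
  move=> Xq n0; have Zq := has_density_norm_sum Xq hXs hind n0.
  have [[mpn _ _] [mq _ _]] := (hpn _ n0, Zq).
  have mN := @measurable_normal_pdf R 0 1.
  split; first exact: measurable_funB.
  apply: L2norm_ae_eq; [exact: measurable_funB|exact: measurable_funB|].
  apply: normal_pdf_sub_ae_eq; exact: has_density_ae_eq (hpn _ n0) Zq.
have ip := has_density_integrable hX.
split=> [cvg0 k k0|_ _ f0].
  (* Convergence to 0 in the extended reals makes the norms eventually finite, which gives the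
     eventual integrability of the squares. *)
  have /fine_cvgP[finL cvgL] := cvg0.
  have ip2 : \forall n \near \oo, (@lebesgue_measure R).-integrable setT
      (EFin \o (fun x => (walk_density p n x - normal_pdf 0 1 x) ^+ 2)).
    near=> n; have n0 : (0 < n)%N by near: n; exact: nbhs_infty_gt.
    have [mq Lq] := L2E p n hX n0.
    apply: L2norm_lty_integrable => //; rewrite -Lq.
    have : L2norm (fun x => pn n x - normal_pdf 0 1 x) \is a fin_num by near: n.
    by rewrite fin_numElt => /andP[].
  have cvgp : (fun n => \int[@lebesgue_measure R]_x
      (walk_density p n x - normal_pdf 0 1 x) ^+ 2) @ \oo --> (0 : R).
    have cvg2 : (fun n => fine (L2norm (fun x => pn n x - normal_pdf 0 1 x)) *
        fine (L2norm (fun x => pn n x - normal_pdf 0 1 x))) @ \oo --> (0 * 0 : R).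
      exact: (cvgM cvgL cvgL).
    rewrite mulr0 in cvg2; apply: cvg_trans cvg2.
    apply: near_eq_cvg; near=> n.
    have n0 : (0 < n)%N by near: n; exact: nbhs_infty_gt.
    have [mq Lq] := L2E p n hX n0.
    have iq : (@lebesgue_measure R).-integrable setT
      (EFin \o (fun x => (walk_density p n x - normal_pdf 0 1 x) ^+ 2)) by near: n.
    rewrite /= Lq L2norm_integrable//= -expr2 sqr_sqrtr//.
    by apply: Rintegral_ge0 => x _; exact: sqr_ge0.
  have s1 : `|cos (pi * k%:~R)| = 1 :> R by exact/sin0cos1/sin_pi_int.
  have mc := measurable_cosM (pi * k%:~R : R).
  have ms := measurable_sinM (pi * k%:~R : R).
  rewrite (char_fun_has_density _ hX).
  rewrite (Rintegral_test_eq0 ip mc (fun x => cos_max _) s1 _ _ _ ip2 cvgp); first last.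
  - exact: Rintegral_uniform_density_cos.
  - by move=> x; have [] := cos_sin_pi_int_shift k x.
  - by move=> x; have [] := cos_sin_pi_int_shift k x.
  rewrite (Rintegral_test_eq0 ip ms (fun x => sin_max _) s1 _ _ _ ip2 cvgp)//.
  - by move=> x; have [] := cos_sin_pi_int_shift k x.
  - by move=> x; have [] := cos_sin_pi_int_shift k x.
  - exact: Rintegral_uniform_density_sin.
have fourier q : has_density P X q -> forall n, {ae @lebesgue_measure R, forall x,
    \sum_(j < n.*2.+1) q (x + 2 * (n%:R - j%:R)) <= 2^-1}.
  move=> Xq; have [_ q0 _] := Xq.
  have qk k : k != 0 -> \int[@lebesgue_measure R]_x (q x * cos (pi * k%:~R * x)) = 0 /\
      \int[@lebesgue_measure R]_x (q x * sin (pi * k%:~R * x)) = 0.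
    by move=> k0; have := f0 k k0; rewrite (char_fun_has_density _ Xq) => -[].
  apply: periodization_ae_le => //.
  - exact: has_density_integrable Xq.
  - exact: has_density_Rintegral1 Xq.
  - by move=> k /qk[].
  - by move=> k /qk[].
pose q x := Num.min (p x) 2^-1.
(* For n = 0 the periodization sum is the single term p x, so p <= 1/2 almost everywhere and
   truncating at 1/2 keeps a density of X. *)
have Xq : has_density P X q.
  apply: has_density_min => //.
  apply: (@filterS _ _ (ae_filter_ringOfSetsType lebesgue_measure) _ _ _
    (fourier p hX 0%N)).
  by move=> x; rewrite big_ord_recl big_ord0 /= subrr mulr0 !addr0.
have [_ q0 _] := Xq.
have q2 x : q x <= 2^-1 by rewrite ge_min lexx orbT.
have iq := has_density_integrable Xq; have q1 := has_density_Rintegral1 Xq.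
have cvgq := cvg_walk_density iq q0 q2 q1 (fourier q Xq).
have cvgs : (fun n => Num.sqrt (\int[@lebesgue_measure R]_x
    (walk_density q n x - normal_pdf 0 1 x) ^+ 2)) @ \oo --> (0 : R).
  have s0 : Num.sqrt x @[x --> (0 : R)] --> (0 : R).
    by have := @sqrt_continuous R 0; rewrite /continuous_at sqrtr0.
  exact: (cvg_comp _ _ cvgq s0).
have : (fun n => (Num.sqrt (\int[@lebesgue_measure R]_x
    (walk_density q n x - normal_pdf 0 1 x) ^+ 2))%:E) @ \oo --> 0%E.
  by apply: cvg_EFin => //; exact: nearW.
apply: cvg_trans; apply: near_eq_cvg; near=> n.
have n0 : (0 < n)%N by near: n; exact: nbhs_infty_gt.
have [_ ->] := L2E q n Xq n0.
have [iqn _] := Rintegral_sqr_walk_density_sub iq q0 q2 q1 (fourier q Xq) n0.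
by rewrite L2norm_integrable.
Unshelve. all: by end_near. Qed.
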